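(* In the setting described in the context, for every $v\in V$, almost surely $R^v_m$ converges uniformly on $[0,1]$ (i.e. in $\|\cdot\|_\infty$) as $m\to\infty$ to a random element $R^v$ of $D$ with $E\|R^v\|_\infty^2<\infty$. The family $(R^v)_{v\in V}$ satisfies, for every $v\in V$, almost surely $$R^v=T^v_1(R^{v1})+T^v_2(R^{v2})+C^v .$$ Moreover, for every $p>1$, every $v\in V$ and every $m\in\mathbb N_0$, $$\big\|\,\|R^v_m\|_\infty\big\|_{L_p}\le\frac{8+2^{-1/p}k_p\,\|Q^\emptyset\|_{L_p}}{1-k_p},\qquad k_p=\Big(\frac{2}{p+1}\Big)^{1/p}.$$
   Context: Notation. $V=\bigcup_{k\ge0}\{1,2\}^k$ is the rooted binary tree of finite words over $\{1,2\}$; $\emptyset$ is the empty word (root), $vw$ is concatenation, $|v|$ is the length, $V_m$ (resp. $V_{<m}$) is the set of words of length $m$ (resp. $<m$). $D=D[0,1]$ is the space of càdlàg functions $[0,1]\to\mathbb R$, $\|f\|_\infty=\sup_t|f(t)|$; $\|X\|_{L_p}=(E|X|^p)^{1/p}$. $(U^v)_{v\in V}$ are i.i.d. random variables uniformly distributed on $[0,1]$. Cost functions: $C(x)=1+2x\ln x+2(1-x)\ln(1-x)$ for $x\in[0,1]$ (with $0\ln0=0$), and for $t,x\in[0,1]$, $C(t,x)=C(x)+2\,\mathbf 1_{t<x}\big(-1+x+(1-t)\ln(1-t)-(1-x)\ln(1-x)-(x-t)\ln(x-t)\big)$. Quicksort limit variables: for $v,w\in V$ put $\ell^v_\emptyset=1$,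 $\ell^v_{w1}=\ell^v_wU^{vw}$, $\ell^v_{w2}=\ell^v_w(1-U^{vw})$ and $Q^v=\lim_{m\to\infty}\sum_{w\in V_{<m}}\ell^v_wC(U^{vw})$; this limit exists a.s. and in $L_2$, $Q^v$ has the mean-zero Quicksort limit distribution (which has finite moments of all orders), and $Q^v=U^vQ^{v1}+(1-U^v)Q^{v2}+C(U^v)$ a.s. Weighted branching structure: for $v\in V$ define random linear maps $T^v_1,T^v_2$ on functions $h:[0,1]\to\mathbb R$ by $(T^v_1h)(t)=\mathbf 1_{t<U^v}\,U^v\,h(1\wedge t/U^v)$ and $(T^v_2h)(t)=\mathbf 1_{t\ge U^v}(1-U^v)\,h\big(0\vee\frac{t-U^v}{1-U^v}\big)$; the random function $C^v(t)=C(t,U^v)+\mathbf 1_{t\ge U^v}U^vQ^{v1}$; path operators $L^v_\emptyset=\mathrm{id}$, $L^v_{wi}=L^v_w\circ T^{vw}_i$ ($i=1,2$); and $R^v_m=\sum_{w\in V_{<m}}L^v_w(C^{vw})$ for $m\in\mathbb N_0$ (so $R^v_0=0$). *)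

(* Defs.v *)
From HB Require Import structures.
From mathcomp Require Import all_boot all_order all_algebra.
From mathcomp Require Import all_classical all_reals all_analysis.
Set Implicit Arguments. Unset Strict Implicit. Unset Printing Implicit Defensive.
Import Order.TTheory GRing.Theory Num.Theory.
Import numFieldNormedType.Exports.
Local Open Scope classical_set_scope.
Local Open Scope ring_scope.

(* Words of the binary tree V: [seq bool]; letter [false] = 1, [true] = 2.
   The word w i (append letter i at the end) is [rcons w i], vw is [v ++ w]. *)
Notation word := (seq bool).

Fixpoint words (n : nat) : seq word :=
  match n with
  | 0 => [:: [::]]
  | n'.+1 => flatten [seq [:: rcons w false; rcons w true] | w <- words n']
  end.

Definition words_lt (m : nat) : seq word := flatten [seq words k | k <- iota 0 m].

Section Defs.
Variable R : realType.

Definition xlnx (x : R) : R := if x == 0 then 0 else x * ln x.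

Definition Cx (x : R) : R := 1 + 2 * xlnx x + 2 * xlnx (1 - x).

Definition Ctx (t x : R) : R :=
  Cx x + 2 * ((if t < x then 1 else 0) * (-1 + x + xlnx (1 - t) - xlnx (1 - x) - xlnx (x - t))).

Definition Top (x : R) (i : bool) (h : R -> R) : R -> R :=
  if i then fun t => (if x <= t then 1 else 0) * ((1 - x) * h (Num.max 0 ((t - x) / (1 - x))))
  else fun t => (if t < x then 1 else 0) * (x * h (Num.min 1 (t / x))).

(* In what follows, u : word -> R is a realization of (U^v)_{v in V}. *)

(* ell^v_w, via ell_empty = 1, ell_{w1} = ell_w U^{vw}, ell_{w2} = ell_w (1 - U^{vw});
   [pre] is the current prefix v w', [acc] is ell^v_{w'}. *)
Fixpoint ellaux (u : word -> R) (pre : word) (acc : R) (w : word) : R :=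
  match w with
  | [::] => acc
  | i :: w' => ellaux u (rcons pre i) (acc * (if i then 1 - u pre else u pre)) w'
  end.
Definition ell (u : word -> R) (v w : word) : R := ellaux u v 1 w.

Definition Qpart (u : word -> R) (v : word) (m : nat) : R :=
  \sum_(w <- words_lt m) ell u v w * Cx (u (v ++ w)).
Definition Q (u : word -> R) (v : word) : R := limn (Qpart u v).

Definition Cfun (u : word -> R) (v : word) : R -> R :=
  fun t => Ctx t (u v) + (if u v <= t then 1 else 0) * (u v * Q u (rcons v false)).

(* Path operators: L^v_empty = id, L^v_{wi} = L^v_w o T^{vw}_i. *)
Fixpoint Laux (u : word -> R) (pre : word) (acc : (R -> R) -> (R -> R)) (w : word)
  : (R -> R) -> (R -> R) :=
  match w with
  | [::] => acc
  | i :: w' => Laux u (rcons pre i) (fun h => acc (Top (u pre) i h)) w'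
  end.
Definition Lop (u : word -> R) (v w : word) : (R -> R) -> (R -> R) := Laux u v id w.

Definition Rm (u : word -> R) (v : word) (m : nat) : R -> R :=
  fun t => \sum_(w <- words_lt m) Lop u v w (Cfun u (v ++ w)) t.

Definition supnorm (f : R -> R) : \bar R :=
  ereal_sup [set (`|f t|)%:E | t in `[0, 1]].

Definition cadlag01 (f : R -> R) : Prop :=
  (forall t, 0 <= t < 1 -> f x @[x --> t^'+] --> f t) /\
  (forall t, 0 < t <= 1 -> cvg (f x @[x --> t^'-])).

Definition kp (p : R) : R := (2 / (p + 1)) `^ p^-1.

End Defs.

Definition mutually_independent d (T : measurableType d) (R : realType)
  (P : probability T R) (I : eqType) (X : I -> T -> R) : Prop :=
  forall (J : seq I) (B : I -> set R), uniq J ->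
    (forall j, measurable (B j)) ->
    P (\big[setI/setT]_(j <- J) (X j @^-1` B j)) =
    (\prod_(j <- J) P (X j @^-1` B j))%E.

(* Main.v *)
Require Import Defs.
From HB Require Import structures.
From mathcomp Require Import all_boot all_order all_algebra.
From mathcomp Require Import ring lra.
From mathcomp Require Import all_classical all_reals all_analysis.
From mathcomp Require Import measurable_realfun.
Set Implicit Arguments. Unset Strict Implicit. Unset Printing Implicit Defensive.
Import Order.TTheory GRing.Theory Num.Theory.
Import numFieldNormedType.Exports.
Local Open Scope classical_set_scope.
Local Open Scope ring_scope.

(* [Top x false h] and [Top x true h] are supported on [t < x] and
   [t >= x], so the increment D_k = R_{k+1} - R_k = sum over |w| = k of
   L_w (C^w) satisfies
     ||D_k^v||^p <= U^p ||D_{k-1}^{v1}||^p + (1 - U)^p ||D_{k-1}^{v2}||^p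
   pathwise, and ||C^v|| <= 8 + U^v |Q^{v1}|.  [Mp] unrolls the right-hand sides
   into measurable majorants M_k of ||D_k||^p (so the measurability of the
   uncountable suprema never matters).  U^v is independent of the variables
   indexed by the subtree below v1, so E M_k = (2 / (p + 1))^k E M_0, and
   Minkowski's inequality gives the L_p bound.  For p = 2 the moment E M_0 is
   finite: E C(U) = 0 cancels the cross terms in the recursion for E Q_m^2, so the
   partial sums Q_m of Q are bounded in L_2, and Fatou applies.  Then
   sum_k (9/8)^(2k) M_k is a.s. finite, which gives ||D_k|| = O((8/9)^k) and hence
   uniform convergence.
   The family U is first replaced by an a.e. equal one with values in ]0, 1[, for
   which all pointwise estimates hold everywhere. *)

(** * Independent families and cylinder sigma-algebras *)

(** The contraction factor is E(U^p + (1 - U)^p) = 2 / (p + 1) = k_p^p, and it is below 1 exactly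
    because p > 1. The two branches must therefore enter through their p-th powers: adding the
    weights U and 1 - U themselves would give the factor 1. Each Q^{v1} depends on infinitely many
    of the variables, while independence is given for finite subfamilies only. A subtree is
    therefore treated as one random element of a path space, where independence and equality of laws
    extend from cylinders by Dynkin's theorem. Q is a total function of the realization: [limn]
    returns a default value where the partial sums diverge. This has to be accounted for in its
    measurability and in its second moment. Moment identities are stated in the extended reals, so
    that finiteness enters only at p = 2. There the rate r = 8/9 is one choice with 2/3 < r^2 < 1.
    Clamping is needed because the branch operators divide by U and 1 - U. *)

(** [B] is a total family constrained only along [J], so repeated indices are harmless and an
    intersection of two cylinders is indexed by the concatenated list. *)
Definition cylinders (R : realType) (I : choiceType) : set (set (I -> R)) :=
  [set X | exists (J : seq I) (B : I -> set R),
     (forall j, measurable (B j)) /\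
     X = [set f | forall j, j \in J -> B j (f j)]].

Definition paths (R : realType) (I : choiceType) : Type :=
  g_sigma_algebraType (@cylinders R I).

HB.instance Definition _ (R : realType) (I : choiceType) :=
  Measurable.copy (paths R I) (g_sigma_algebraType (@cylinders R I)).

Section cylinders_theory.
Context (R : realType) (I : choiceType).
Implicit Types (J : seq I) (B : I -> set R).

Lemma cylinders_setI : setI_closed (@cylinders R I).
Proof.
move=> _ _ [J1 [B1 [mB1 ->]]] [J2 [B2 [mB2 ->]]].
exists (J1 ++ J2), (fun j => (if j \in J1 then B1 j else setT) `&`
                             (if j \in J2 then B2 j else setT)); split.
  by move=> j; apply: measurableI; case: ifP.
apply/seteqP; split => [f [f1 f2] j _|f /= fJ].
  by split; case: ifP => // h; [exact: f1|exact: f2].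
split=> j jJ; have := fJ j; rewrite mem_cat jJ ?orbT => /(_ isT)[];
  by case: ifP.
Qed.

Lemma cylinders_setT : @cylinders R I setT.
Proof.
exists [::], (fun=> setT); split => //.
by apply/seteqP; split.
Qed.

Lemma measurable_coord (i : I) :
  measurable_fun setT (fun f : paths R I => f i : R).
Proof.
move=> _ B mB; rewrite setTI; apply: sub_sigma_algebra.
exists [:: i], (fun=> B); split => //.
apply/seteqP; split => [f fB j|f /(_ i)/=]; first by rewrite inE => /eqP ->.
by apply; rewrite inE.
Qed.

Lemma measurable_paths d (T : measurableType d) (h : T -> paths R I) :
  (forall i, measurable_fun setT (fun x => h x i)) -> measurable_fun setT h.
Proof.
move=> mh; apply: (@measurability _ _ T (paths R I) setT h (@cylinders R I)) => //.
move=> _ [_ [J [B [mB ->]]] <-]; rewrite setTI.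
rewrite [X in measurable X](_ : _ =
    \big[setI/setT]_(j <- J) ((fun x => h x j) @^-1` B j)).
  apply: bigsetI_measurable => j _.
  by rewrite -[X in measurable X]setTI; exact: mh.
rewrite -bigcap_seq; apply/seteqP; split => x /= hx j /=; exact: hx.
Qed.

(** Dynkin's theorem: cylinders form a generating pi-system that contains the whole space. *)
Lemma paths_measure_unique (m1 m2 : {measure set (paths R I) -> \bar R}) :
  (m1 setT < +oo)%E -> (forall A, @cylinders R I A -> m1 A = m2 A) ->
  forall A, measurable A -> m1 A = m2 A.
Proof.
move=> m1oo m12; apply: (@measure_unique _ R (paths R I) (@cylinders R I)
  (fun=> setT)) => //.
- exact: cylinders_setI.
- by move=> _; exact: cylinders_setT.
- by rewrite bigcup_const.
Qed.

End cylinders_theory.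

Lemma probability_bounded_integrable (R : realType) d (T : measurableType d)
    (P : probability T R) (f : T -> R) (c : R) :
  measurable_fun setT f -> (forall w, `|f w| <= c) ->
  P.-integrable setT (EFin \o f).
Proof.
move=> mf fc; apply: (@measurable_bounded_integrable _ _ _ P f) => //.
  exact: (le_lt_trans (probability_le1 P measurableT) (ltry 1)).
exists c; split; first exact: num_real.
by move=> M cM w _ /=; rewrite (le_trans (fc w))// ltW.
Qed.

Section independent_families.
Context (R : realType) d (T : measurableType d) (P : probability T R).
Context (K : choiceType) (X : K -> T -> R).
Hypothesis mX : forall k, measurable_fun setT (X k).
Hypothesis indX : mutually_independent P X.
Hypothesis idX : forall k l B, measurable B -> P (X k @^-1` B) = P (X l @^-1` B).

(** Reindexing along a map, instead of restricting to a subset, lets the subtree below v be read as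
    a copy of the whole tree, through [cat v]. *)
Definition subfam (I : choiceType) (a : I -> K) : T -> paths R I :=
  fun w i => X (a i) w.

Lemma measurable_subfam (I : choiceType) (a : I -> K) :
  measurable_fun setT (subfam a).
Proof. by apply: measurable_paths => i; exact: mX. Qed.

HB.instance Definition _ (I : choiceType) (a : I -> K) :=
  isMeasurableFun.Build _ _ _ _ (subfam a) (@measurable_subfam I a).

Lemma subfam_cylinder (I : choiceType) (a : I -> K) (J : seq I) (B : I -> set R) :
  injective a -> (forall j, measurable (B j)) ->
  P (subfam a @^-1` [set f | forall j, j \in J -> B j (f j)]) =
  (\prod_(j <- undup J) P (X (a j) @^-1` B j))%E.
Proof.
move=> inj_a mB.
(* Transports [B] from [I] to [K]: injectivity gives back [B j] at [a j], and the condition is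
   vacuous off the image of [a]. *)
pose B' k := [set r | forall j, a j = k -> B j r].
have B'E j : B' (a j) = B j.
  by apply/seteqP; split => [r /(_ j erefl)//|r Br i /inj_a ->].
have mB' k : measurable (B' k).
  have [[j <-]|nj] := pselect (exists j, a j = k); first by rewrite B'E.
  rewrite (_ : B' k = setT)//; apply/seteqP; split => // r _ j ajk.
  by exfalso; apply: nj; exists j.
transitivity (P (\big[setI/setT]_(k <- map a (undup J)) (X k @^-1` B' k))).
  congr (P _); rewrite -bigcap_seq; apply/seteqP; split => w /= hw.
    move=> _ /mapP[j jJ ->] /=; rewrite B'E; apply: (hw j).
    by rewrite mem_undup in jJ.
  move=> j jJ; rewrite -B'E; apply: (hw (a j)).
  by apply/mapP; exists j; rewrite ?mem_undup.
rewrite indX//; last by rewrite map_inj_uniq// undup_uniq.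
by rewrite big_map; apply: eq_bigr => j _; rewrite B'E.
Qed.

Lemma subfam_law (I : choiceType) (a b : I -> K) : injective a -> injective b ->
  forall E : set (paths R I), measurable E ->
    P (subfam a @^-1` E) = P (subfam b @^-1` E).
Proof.
move=> ia ib E mE.
apply: (@paths_measure_unique _ _ (pushforward P (subfam a))
          (pushforward P (subfam b)) _ _ E mE) => [|_ [J [B [mB ->]]]].
  by rewrite [X in (X < _)%E](_ : _ = P setT)// probability_setT ltry.
rewrite /= /pushforward /= !subfam_cylinder//.
by apply: eq_bigr => j _; exact: idX.
Qed.

Lemma subfam_indep (I J : choiceType) (a : I -> K) (b : J -> K) :
  injective a -> injective b -> (forall i j, a i <> b j) ->
  forall (E : set (paths R I)) (F : set (paths R J)),
    measurable E -> measurable F ->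
    P (subfam a @^-1` E `&` subfam b @^-1` F) =
    (P (subfam a @^-1` E) * P (subfam b @^-1` F))%E.
Proof.
move=> ia ib ab E F mE mF.
have mpre (I' : choiceType) (a' : I' -> K) A : measurable A -> measurable (subfam a' @^-1` A).
  by move=> mA; rewrite -[X in measurable X]setTI; exact: measurable_subfam.
have cyl_cyl E1 F1 : @cylinders R I E1 -> @cylinders R J F1 ->
    P (subfam a @^-1` E1 `&` subfam b @^-1` F1) =
    (P (subfam a @^-1` E1) * P (subfam b @^-1` F1))%E.
  move=> [J1 [B1 [mB1 ->]]] [J2 [B2 [mB2 ->]]].
  (* As the images of [a] and [b] are disjoint, the two cylinders together form a single cylinder
     over [I + J]. *)
  pose c (s : I + J) := match s with inl i => a i | inr j => b j end.
  have ic : injective c.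
    move=> [i|i] [j|j] /=; [by move/ia ->|by move/ab|by move/esym/ab|by move/ib ->].
  pose B (s : I + J) := match s with inl i => B1 i | inr j => B2 j end.
  pose L := map inl (undup J1) ++ map inr (undup J2) : seq (I + J).
  have uL : uniq L.
    rewrite cat_uniq !map_inj_uniq ?undup_uniq//=; [|by move=> ? ? []|by move=> ? ? []].
    by rewrite andbT; apply/hasPn => _ /mapP[j _ ->]; apply/negP => /mapP[].
  have mB s : measurable (B s) by case: s.
  rewrite !subfam_cylinder// (_ : _ `&` _ =
    subfam c @^-1` [set f | forall s, s \in L -> B s (f s)]).
    rewrite subfam_cylinder// undup_id// big_cat !big_map /=.
    by congr (_ * _)%E; apply: eq_bigr.
  apply/seteqP; split => [w /= [w1 w2] s|w /= hw].
    rewrite mem_cat => /orP[] /mapP[j]; rewrite mem_undup => jJ ->/=;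
      [exact: w1|exact: w2].
  by split => j jJ; [have := hw (inl j)|have := hw (inr j)];
     apply; rewrite mem_cat; apply/orP; [left|right]; apply/mapP;
     exists j; rewrite ?mem_undup.
(* The product formula is extended one factor at a time: for fixed [F1] both sides are finite
   measures in [E1] that agree on cylinders. The second factor is then treated in the same way. *)
have meas_cyl E1 F1 : measurable E1 -> @cylinders R J F1 ->
    P (subfam a @^-1` E1 `&` subfam b @^-1` F1) =
    (P (subfam a @^-1` E1) * P (subfam b @^-1` F1))%E.
  move=> mE1 cF1.
  have mF1 : @measurable _ (paths R J) F1 by apply: sub_sigma_algebra.
  have mF1' := mpre _ b _ mF1.
  pose m1 := pushforward (mrestr P mF1') (subfam a).
  pose m2 := mscale (NngNum (fine_ge0 (measure_ge0 P (subfam b @^-1` F1))))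
    (distribution P (subfam a)).
  have m2E A : m2 A = (P (subfam a @^-1` A) * P (subfam b @^-1` F1))%E.
    by rewrite /m2 /mscale/= muleC fineK// fin_num_measure.
  rewrite -m2E; apply: (@paths_measure_unique R I m1 m2) => //; last first.
    by move=> A cA; apply: etrans (esym (m2E A)); rewrite -cyl_cyl.
  apply: (@le_lt_trans _ _ 1%E); rewrite ?ltry//.
  apply: (@probability_le1 _ _ _ P); apply: measurableI => //.
  by rewrite -[X in measurable X]setTI; apply: measurable_subfam.
have mE' := mpre _ a _ mE.
pose m1 := pushforward (mrestr P mE') (subfam b).
pose m2 := mscale (NngNum (fine_ge0 (measure_ge0 P (subfam a @^-1` E))))
  (distribution P (subfam b)).
have m2E A : m2 A = (P (subfam a @^-1` E) * P (subfam b @^-1` A))%E.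
  by rewrite /m2 /mscale/= fineK// fin_num_measure.
rewrite -m2E setIC; apply: (@paths_measure_unique R J m1 m2) => //; last first.
  by move=> A cA; apply: etrans (esym (m2E A)); rewrite -meas_cyl// setIC.
apply: (@le_lt_trans _ _ 1%E); rewrite ?ltry//.
  apply: (@probability_le1 _ _ _ P); apply: measurableI => //.
  by rewrite -[X in measurable X]setTI; apply: measurable_subfam.
Qed.

Lemma subfam_ge0_law (I : choiceType) (a b : I -> K) (F : paths R I -> \bar R) :
  injective a -> injective b -> measurable_fun setT F -> (forall x, 0 <= F x)%E ->
  (\int[P]_w F (subfam a w) = \int[P]_w F (subfam b w))%E.
Proof.
move=> ia ib mF F0.
rewrite -(@ge0_integral_distribution _ _ _ _ _ P (subfam a) F)//.
rewrite -(@ge0_integral_distribution _ _ _ _ _ P (subfam b) F)//.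
by apply: eq_measure_integral => E mE _; exact: subfam_law.
Qed.

Section joint_law.
Context (I J : choiceType) (a : I -> K) (b : J -> K).
Hypotheses (inj_a : injective a) (inj_b : injective b).
Hypothesis ab : forall i j, a i <> b j.

Let pr w := (subfam a w, subfam b w).
Let lawa : probability (paths R I) R := distribution P (subfam a).
Let lawb : probability (paths R J) R := distribution P (subfam b).

Let mpr : measurable_fun setT pr.
Proof. by apply: measurable_fun_pair => //; exact: measurable_subfam. Qed.

HB.instance Definition _ := isMeasurableFun.Build _ _ _ _ pr mpr.

Let joint_law A : measurable A -> (lawa \x lawb)%E A = distribution P pr A.
Proof.
by apply: product_measure_unique => E F mE mF; exact: subfam_indep.
Qed.

(** By independence the joint law is the product of the marginal laws, so Tonelli's theorem
    separates the factors. *)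
Lemma subfam_ge0_expectationM (F : paths R I -> \bar R) (G : paths R J -> \bar R) :
  measurable_fun setT F -> measurable_fun setT G ->
  (forall x, 0 <= F x)%E -> (forall y, 0 <= G y)%E ->
  (\int[P]_w (F (subfam a w) * G (subfam b w)) =
   \int[P]_w F (subfam a w) * \int[P]_w G (subfam b w))%E.
Proof.
move=> mF mG F0 G0.
pose h (z : paths R I * paths R J) : \bar R := (F z.1 * G z.2)%E.
have mh : measurable_fun setT h.
  by apply: emeasurable_funM; [exact: (measurableT_comp mF)|exact: (measurableT_comp mG)].
have h0 z : (0 <= h z)%E by rewrite mule_ge0.
transitivity (\int[distribution P pr]_z h z)%E.
  by rewrite ge0_integral_distribution.
transitivity (\int[(lawa \x lawb)%E]_z h z)%E.
  by apply: eq_measure_integral => A mA _; first [exact: joint_law|exact/esym/joint_law].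
rewrite fubini_tonelli1// /fubini_F /h /=.
under eq_integral do rewrite ge0_integralZl//.
rewrite ge0_integralZr//; last exact: integral_ge0.
by rewrite !ge0_integral_distribution.
Qed.

(** Signed counterpart, made for the cross terms: boundedness permits Fubini's theorem, and the
    inner integral over the centred factor vanishes. *)
Lemma subfam_expectationM0 (F : paths R I -> R) (G : paths R J -> R) (c : R) :
  measurable_fun setT F -> measurable_fun setT G ->
  (forall w, `|F (subfam a w)| <= c) -> (forall w, `|G (subfam b w)| <= c) ->
  (\int[P]_w (G (subfam b w))%:E = 0)%E ->
  (\int[P]_w (F (subfam a w) * G (subfam b w))%:E = 0)%E.
Proof.
move=> mF mG Fc Gc G0.
pose h (z : paths R I * paths R J) : R := F z.1 * G z.2.
have mh : measurable_fun setT h.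
  by apply: measurable_funM;
    [exact: (measurableT_comp mF)|exact: (measurableT_comp mG)].
have mEh : measurable_fun setT (EFin \o h) by exact/measurable_EFinP.
have ih : P.-integrable setT (EFin \o h \o pr).
  apply: (@probability_bounded_integrable _ _ _ P (h \o pr) (c * c)).
    exact: (measurableT_comp mh mpr).
  by move=> w; rewrite /h/= normrM ler_pM.
have iG : P.-integrable setT (EFin \o (G \o subfam b)).
  apply: (@probability_bounded_integrable _ _ _ P _ c) => //.
  exact: (measurableT_comp mG (measurable_subfam b)).
have ih' : (lawa \x lawb)%E.-integrable setT (EFin \o h).
  apply/integrableP; split => //.
  rewrite (@eq_measure_integral _ _ _ _ (distribution P pr)); last first.
    by move=> A mA _; first [exact: joint_law|exact/esym/joint_law].
  rewrite ge0_integral_distribution//; last exact: measurableT_comp.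
  by have /integrableP[] := ih.
transitivity (\int[distribution P pr]_z (h z)%:E)%E.
  by rewrite integral_distribution.
transitivity (\int[(lawa \x lawb)%E]_z (h z)%:E)%E.
  by apply: eq_measure_integral => A mA _; first [exact: joint_law|exact/esym/joint_law].
rewrite -integral12_prod_meas1// /fubini_F /h /=.
rewrite integral0_eq// => x _.
under eq_integral do rewrite EFinM.
have mEG : measurable_fun setT (EFin \o G) by exact/measurable_EFinP.
rewrite integralZl//; last exact: integrable_pushforward.
rewrite (_ : (\int[lawb]_y (G y)%:E)%E = 0%E) ?mule0//.
by rewrite integral_distribution.
Qed.

End joint_law.

End independent_families.

(** * Recursions and pathwise bounds *)

Section word_sums.
Context (V : nmodType).
Implicit Types (F : word -> V).

Lemma big_words_rcons F n :
  \sum_(w <- words n.+1) F w =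
  \sum_(w <- words n) (F (rcons w false) + F (rcons w true)).
Proof.
rewrite /= big_flatten big_map; apply: eq_bigr => w _.
by rewrite big_cons big_seq1.
Qed.

(** [words] grows at the end of a word, whereas the recursions for Q and R split off its first
    letter. *)
Lemma big_words_cons F n :
  \sum_(w <- words n.+1) F w =
  \sum_(w <- words n) F (false :: w) + \sum_(w <- words n) F (true :: w).
Proof.
elim: n F => [|n IHn] F; first by rewrite big_words_rcons !big_seq1.
by rewrite big_words_rcons IHn !big_words_rcons.
Qed.

Lemma big_words_lt F m :
  \sum_(w <- words_lt m) F w = \sum_(k < m) \sum_(w <- words k) F w.
Proof.
rewrite /words_lt big_flatten big_map -(big_mkord xpredT (fun k => \sum_(w <- words k) F w)).
by rewrite /index_iota subn0.
Qed.

Lemma big_words_ltS F m :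
  \sum_(w <- words_lt m.+1) F w = F [::] +
    (\sum_(w <- words_lt m) F (false :: w) + \sum_(w <- words_lt m) F (true :: w)).
Proof.
rewrite !big_words_lt big_ord_recl big_seq1 -big_split; congr (_ + _).
by apply: eq_bigr => k _; exact: (big_words_cons F k).
Qed.

End word_sums.

Section recursions.
Context (R : realType).
Implicit Types (u : word -> R) (v w : word) (h : R -> R).

Lemma ellaux_acc u v (x : R) w : ellaux u v x w = x * ellaux u v 1 w.
Proof.
elim: w v x => [|i w IHw] v x /=; first by rewrite mulr1.
by rewrite IHw [in RHS]IHw mul1r mulrA.
Qed.

Lemma ell_cons u v i w :
  ell u v (i :: w) = (if i then 1 - u v else u v) * ell u (rcons v i) w.
Proof. by rewrite /ell /= ellaux_acc mul1r. Qed.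

Lemma Qpart0 u v : Qpart u v 0 = 0.
Proof. by rewrite /Qpart big_nil. Qed.

Lemma QpartS u v m : Qpart u v m.+1 = Cx (u v) +
  (u v * Qpart u (rcons v false) m + (1 - u v) * Qpart u (rcons v true) m).
Proof.
rewrite /Qpart big_words_ltS cats0 mul1r !mulr_sumr; congr (_ + (_ + _));
  by apply: eq_bigr => w _; rewrite ell_cons cat_rcons mulrA.
Qed.

(** With [w] empty this makes the value at v one fixed functional, independent of v, of the
    realization shifted to the subtree below v. *)
Lemma Qpart_cat u v w m : Qpart u (v ++ w) m = Qpart (fun x => u (v ++ x)) w m.
Proof.
elim: m w => [|m IHm] w; first by rewrite !Qpart0.
by rewrite !QpartS -!IHm !rcons_cat.
Qed.

Lemma Q_cat u v w : Q u (v ++ w) = Q (fun x => u (v ++ x)) w.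
Proof. by rewrite /Q; congr (limn _); apply/funext => m; exact: Qpart_cat. Qed.

Lemma Laux_acc u v (acc : (R -> R) -> R -> R) w h :
  Laux u v acc w h = acc (Laux u v id w h).
Proof.
elim: w v acc => [|i w IHw] v acc //=.
by rewrite IHw [in RHS]IHw.
Qed.

Lemma Lop_cons u v i w h :
  Lop u v (i :: w) h = Top (u v) i (Lop u (rcons v i) w h).
Proof. by rewrite /Lop /= Laux_acc. Qed.

Lemma Top_sum (x : R) i (s : seq word) (F : word -> R -> R) t :
  Top x i (fun y => \sum_(w <- s) F w y) t = \sum_(w <- s) Top x i (F w) t.
Proof. by case: i => /=; rewrite !mulr_sumr. Qed.

Definition Rdiff u v k t : R :=
  \sum_(w <- words k) Lop u v w (Cfun u (v ++ w)) t.

Lemma Rm_Rdiff u v m t : Rm u v m t = \sum_(k < m) Rdiff u v k t.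
Proof. exact: big_words_lt. Qed.

Lemma Rdiff0 u v t : Rdiff u v 0 t = Cfun u v t.
Proof. by rewrite /Rdiff big_seq1 cats0. Qed.

Lemma RdiffS u v k t : Rdiff u v k.+1 t =
  Top (u v) false (Rdiff u (rcons v false) k) t +
  Top (u v) true (Rdiff u (rcons v true) k) t.
Proof.
rewrite /Rdiff big_words_cons !Top_sum; congr (_ + _);
  by apply: eq_bigr => w _; rewrite Lop_cons cat_rcons.
Qed.

Lemma Rm0 u v t : Rm u v 0 t = 0.
Proof. by rewrite /Rm big_nil. Qed.

Lemma RmS u v m t : Rm u v m.+1 t =
  Cfun u v t + (Top (u v) false (Rm u (rcons v false) m) t +
                Top (u v) true (Rm u (rcons v true) m) t).
Proof.
rewrite /Rm big_words_ltS cats0 !Top_sum; congr (_ + (_ + _));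
  by apply: eq_bigr => w _; rewrite Lop_cons cat_rcons.
Qed.

Lemma xlnxE (x : R) : xlnx x = x * ln x.
Proof. by rewrite /xlnx; case: eqP => // ->; rewrite mul0r. Qed.

(** This is ln y <= y - 1 at y = 1 / x, multiplied by x. *)
Lemma xlnx_ge (x : R) : 0 <= x -> x - 1 <= xlnx x.
Proof.
rewrite xlnxE le_eqVlt => /predU1P[<-|x0]; first by rewrite mul0r sub0r lerN10.
have h : ln x^-1 <= x^-1 - 1.
  have := @le_ln1Dx R (x^-1 - 1); rewrite (addrC 1) subrK; apply.
  by rewrite ltrBrDr addrC subrr invr_gt0.
rewrite lnV ?posrE// in h.
have : x * (1 - x^-1) <= x * ln x by rewrite ler_pM2l//; lra.
by rewrite mulrBr mulr1 divff// gt_eqF.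
Qed.

Lemma xlnx_le0 (x : R) : 0 <= x <= 1 -> xlnx x <= 0.
Proof.
by move=> /andP[x0 x1]; rewrite xlnxE mulr_ge0_le0// ln_le0.
Qed.

Lemma xlnx_bound (x : R) : 0 <= x <= 1 -> -1 <= xlnx x <= 0.
Proof.
move=> x01; rewrite xlnx_le0// andbT.
by case/andP: x01 => x0 _; have := xlnx_ge x0; lra.
Qed.

Lemma Cx_bound (x : R) : 0 <= x <= 1 -> `|Cx x| <= 3.
Proof.
move=> x01.
have := xlnx_bound x01; have : 0 <= 1 - x <= 1 by lra.
by move/xlnx_bound => h1 h2; rewrite /Cx ler_norml; lra.
Qed.

(** Every [xlnx] term lies in [-1, 0]. For t < x the terms [xlnx (1 - x)] cancel and the value lies
    in [-5, 3]; otherwise [Cx_bound] applies. The constant 8 is the one of the final bound. *)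
Lemma Ctx_bound (t x : R) : 0 <= t <= 1 -> 0 <= x <= 1 -> `|Ctx t x| <= 8.
Proof.
move=> t01 x01; have := Cx_bound x01; rewrite /Ctx; case: ifPn => tx.
  have h1 : 0 <= 1 - t <= 1 by lra.
  have h2 : 0 <= 1 - x <= 1 by lra.
  have h3 : 0 <= x - t <= 1 by lra.
  have := xlnx_bound x01; have := xlnx_bound h1; have := xlnx_bound h2.
  have := xlnx_bound h3; rewrite /Cx !ler_norml; lra.
by rewrite mul0r mulr0 addr0 => /le_trans; apply; lra.
Qed.

End recursions.

Section pointwise_bounds.
Context (R : realType) (u : word -> R).
Hypothesis u01 : forall v, 0 < u v < 1.
Implicit Types (v w : word).

Let u_ge0 v : 0 <= u v. Proof. by have /andP[/ltW] := u01 v. Qed.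
Let onem_u_ge0 v : 0 <= 1 - u v. Proof. by have := u01 v; lra. Qed.
Let u_le01 v : 0 <= u v <= 1. Proof. by have := u01 v; lra. Qed.

(** Crude and growing with m: it only serves to make products of partial sums bounded, hence
    integrable. *)
Lemma Qpart_bound v m : `|Qpart u v m| <= 3 * m%:R.
Proof.
elim: m v => [|m IHm] v; first by rewrite Qpart0 normr0 mulr0.
rewrite QpartS; have h1 := IHm (rcons v false); have h2 := IHm (rcons v true).
have h3 := Cx_bound (u_le01 v); rewrite -natr1.
rewrite (le_trans (ler_normD _ _))//.
apply: (le_trans (lerD h3 (ler_normD _ _))).
rewrite !normrM (ger0_norm (u_ge0 v)) (ger0_norm (onem_u_ge0 v)).
have := ler_wpM2l (u_ge0 v) h1; have := ler_wpM2l (onem_u_ge0 v) h2; lra.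
Qed.

Fixpoint Mp (p : R) v k : R :=
  match k with
  | 0 => (8 + u v * `|Q u (rcons v false)|) `^ p
  | k'.+1 => u v `^ p * Mp p (rcons v false) k' +
             (1 - u v) `^ p * Mp p (rcons v true) k'
  end.

Lemma Mp_ge0 p v k : 0 <= Mp p v k.
Proof.
elim: k v => [|k IHk] v /=; first exact: powR_ge0.
by rewrite addr_ge0// mulr_ge0// powR_ge0.
Qed.

Lemma Cfun_bound v t : 0 <= t <= 1 ->
  `|Cfun u v t| <= 8 + u v * `|Q u (rcons v false)|.
Proof.
move=> t01; rewrite /Cfun (le_trans (ler_normD _ _))// lerD//.
  exact: Ctx_bound.
by case: ifP => _; rewrite ?mul1r ?mul0r ?normr0 ?mulr_ge0// normrM ger0_norm.
Qed.

Lemma Top_left_arg (x t : R) : 0 < x -> t < x -> Num.min 1 (t / x) = t / x.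
Proof. by move=> x0 tx; apply/min_idPr; rewrite ler_pdivrMr// mul1r ltW. Qed.

Lemma Top_right_arg (x t : R) : x < 1 -> x <= t ->
  Num.max 0 ((t - x) / (1 - x)) = (t - x) / (1 - x).
Proof. by move=> x1 xt; apply/max_idPr; rewrite divr_ge0; lra. Qed.

(** At each t only one branch is active, so a p-th power of the sum is the p-th power of one term
    and no constant is lost. *)
Lemma Top_cases (x t : R) (h1 h2 : R -> R) : 0 < x < 1 -> 0 <= t <= 1 ->
  Top x false h1 t + Top x true h2 t =
  if t < x then x * h1 (t / x) else (1 - x) * h2 ((t - x) / (1 - x)).
Proof.
move=> /andP[x0 x1] t01; rewrite /=; case: ltP => tx.
  by rewrite Top_left_arg// mul1r mul0r addr0.
by rewrite Top_right_arg// mul1r mul0r add0r.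
Qed.

Lemma left_arg_itv (x t : R) : 0 < x < 1 -> 0 <= t <= 1 -> t < x -> 0 <= t / x <= 1.
Proof.
move=> x01 t01 tx; rewrite divr_ge0; [|lra|lra].
by rewrite ler_pdivrMr; lra.
Qed.

Lemma right_arg_itv (x t : R) : 0 < x < 1 -> 0 <= t <= 1 -> x <= t ->
  0 <= (t - x) / (1 - x) <= 1.
Proof.
move=> x01 t01 xt; rewrite divr_ge0; [|lra|lra].
by rewrite ler_pdivrMr; lra.
Qed.

Lemma Rdiff_powR_bound (p : R) v k t : 0 <= p -> 0 <= t <= 1 ->
  `|Rdiff u v k t| `^ p <= Mp p v k.
Proof.
move=> p0; elim: k v t => [|k IHk] v t t01.
  by rewrite Rdiff0; apply: ge0_ler_powR; rewrite ?nnegrE ?Cfun_bound//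
     addr_ge0// mulr_ge0.
rewrite RdiffS Top_cases//=; case: ltP => tx; rewrite normrM powRM//.
  rewrite (ger0_norm (u_ge0 v)); apply: ler_wpDr.
    by rewrite mulr_ge0 ?Mp_ge0 ?powR_ge0.
  by rewrite ler_wpM2l ?powR_ge0// IHk// left_arg_itv.
rewrite (ger0_norm (onem_u_ge0 v)); apply: ler_wpDl.
  by rewrite mulr_ge0 ?Mp_ge0 ?powR_ge0.
by rewrite ler_wpM2l ?powR_ge0// IHk// right_arg_itv.
Qed.

Lemma Rdiff_bound (p : R) v k t : 0 < p -> 0 <= t <= 1 ->
  `|Rdiff u v k t| <= Mp p v k `^ p^-1.
Proof.
move=> p0 t01; have := Rdiff_powR_bound v k (ltW p0) t01.
move/(ge0_ler_powR (_ : 0 <= p^-1)); rewrite !nnegrE invr_ge0 ltW// powR_ge0 Mp_ge0.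
by rewrite -powRrM divff ?gt_eqF// powRr1//; apply.
Qed.

End pointwise_bounds.

(** * Cadlag functions *)

Section cadlag_closure.
Context (R : realType).
Implicit Types (f g h : R -> R) (t x : R).

(** One-sided limits are put in epsilon form, the left one as a Cauchy condition, so that no limit
    value has to be carried through sums, affine changes of variable, gluing and uniform limits. *)
Definition rcont f t := forall e, 0 < e ->
  exists2 r, 0 < r & forall s, t < s < t + r -> `|f s - f t| < e.

Definition lcauchy f t := forall e, 0 < e ->
  exists2 r, 0 < r & forall s s', t - r < s < t -> t - r < s' < t -> `|f s - f s'| < e.

(** Required on the whole line, so that the closure properties need no conditions at endpoints; the
    passage to [0, 1] happens only for the uniform limit. *)
Definition cadlag f := forall t, rcont f t /\ lcauchy f t.

Lemma rcontP f t : rcont f t -> f x @[x --> t^'+] --> f t.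
Proof.
move=> ft; apply/cvgrPdist_lt => e /ft[r r0 fr].
near=> s; rewrite distrC; apply: fr; apply/andP; split; near: s.
  exact: nbhs_right_gt.
by apply: nbhs_right_lt; rewrite ltrDl.
Unshelve. all: by end_near. Qed.

Lemma lcauchyP f t : lcauchy f t -> cvg (f x @[x --> t^'-]).
Proof.
move=> ft; apply: cauchy_cvg; apply/cauchyP => e /ft[r r0 fr].
exists (f (t - r / 2)).
suff : \forall s \near t^'-, ball (f (t - r / 2)) e (f s) by [].
near=> s; rewrite /ball/=; apply: fr.
  by apply/andP; split; lra.
apply/andP; split; near: s; last exact: nbhs_left_lt.
by apply: nbhs_left_gt; rewrite ltrBlDr ltrDl.
Unshelve. all: by end_near. Qed.

Lemma continuous_cadlag f : continuous f -> cadlag f.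
Proof.
move=> cf t; split => e e0.
  have /cvgrPdist_lt/(_ _ e0)[r/= r0 fr] := cf t.
  exists r => // s /andP[s1 s2]; rewrite distrC; apply: fr => /=.
  by rewrite ltr_distlC; lra.
have e20 : 0 < e / 2 by rewrite divr_gt0.
have /cvgrPdist_lt/(_ _ e20)[r/= r0 fr] := cf t.
exists r => // s s' /andP[s1 s2] /andP[s1' s2'].
have /= h1 : ball t r s by rewrite /ball/= ltr_distlC; lra.
have /= h2 : ball t r s' by rewrite /ball/= ltr_distlC; lra.
have := fr _ h1; have := fr _ h2; rewrite /= !ltr_norml; lra.
Qed.

Lemma cadlagD f g : cadlag f -> cadlag g -> cadlag (fun t => f t + g t).
Proof.
move=> cf cg t; have [rf lf] := cf t; have [rg lg] := cg t.
split => e e0; have e20 : 0 < e / 2 by rewrite divr_gt0.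
  have [r1 r10 h1] := rf _ e20; have [r2 r20 h2] := rg _ e20.
  exists (Num.min r1 r2); first by rewrite lt_min r10.
  move=> s /andP[s1]; rewrite -ltrBlDl lt_min => /andP[s2 s3].
  have := h1 s; have := h2 s.
  rewrite (_ : t < s < t + r1); last by apply/andP; split; lra.
  rewrite (_ : t < s < t + r2); last by apply/andP; split; lra.
  move=> /(_ isT) + /(_ isT); rewrite !ltr_norml; lra.
have [r1 r10 h1] := lf _ e20; have [r2 r20 h2] := lg _ e20.
exists (Num.min r1 r2); first by rewrite lt_min r10.
move=> s s'; rewrite ltrBlDl -!ltrBlDr !lt_min => /andP[/andP[s1 s2] s3].
rewrite ltrBlDl -!ltrBlDr lt_min => /andP[/andP[s1' s2'] s3'].
have := h1 s s'; have := h2 s s'.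
rewrite (_ : t - r1 < s < t); last by apply/andP; split; lra.
rewrite (_ : t - r2 < s < t); last by apply/andP; split; lra.
rewrite (_ : t - r1 < s' < t); last by apply/andP; split; lra.
rewrite (_ : t - r2 < s' < t); last by apply/andP; split; lra.
move=> /(_ isT isT) + /(_ isT isT); rewrite !ltr_norml; lra.
Qed.

Lemma cadlagZ (c : R) f : cadlag f -> cadlag (fun t => c * f t).
Proof.
move=> cf t; have [rf lf] := cf t.
have c0 : 0 < `|c| + 1 by rewrite ltr_wpDl.
split => e e0; have e20 : 0 < e / (`|c| + 1) by rewrite divr_gt0.
  have [r r0 h] := rf _ e20; exists r => // s /h.
  rewrite -mulrBr normrM ltr_pdivlMr// => /(le_lt_trans _); apply.
  by rewrite mulrC ler_wpM2l// lerDl.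
have [r r0 h] := lf _ e20; exists r => // s s' s1 /(h _ _ s1).
rewrite -mulrBr normrM ltr_pdivlMr// => /(le_lt_trans _); apply.
by rewrite mulrC ler_wpM2l// lerDl.
Qed.

Lemma cadlag_affine (a b : R) f : 0 < a -> cadlag f -> cadlag (fun t => f (a * t + b)).
Proof.
move=> a0 cf t; have [rf lf] := cf (a * t + b); split => e e0.
  have [r r0 h] := rf _ e0; exists (r / a); first by rewrite divr_gt0.
  move=> s /andP[s1]; rewrite -ltrBlDl ltr_pdivlMr// => s2.
  have s3 : a * t < a * s by rewrite ltr_pM2l.
  by apply: h; apply/andP; split; lra.
have [r r0 h] := lf _ e0; exists (r / a); first by rewrite divr_gt0.
move=> s s'; rewrite ltrBlDl -ltrBlDr ltr_pdivlMr// => /andP[s1 s2].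
rewrite ltrBlDl -ltrBlDr ltr_pdivlMr// => /andP[s1' s2'].
have s3 : a * s < a * t by rewrite ltr_pM2l.
have s3' : a * s' < a * t by rewrite ltr_pM2l.
by apply: h; apply/andP; split; lra.
Qed.

Lemma cadlag_glue x f g : cadlag f -> cadlag g ->
  cadlag (fun t => if t < x then f t else g t).
Proof.
move=> cf cg t; have [rf lf] := cf t; have [rg lg] := cg t.
split => e e0.
  have [tx|xt] := ltP t x.
    have [r r0 h] := rf _ e0; exists (Num.min r (x - t)).
      by rewrite lt_min r0 subr_gt0.
    move=> s /andP[s1]; rewrite -ltrBlDl lt_min => /andP[s2 s3].
    rewrite ifT; last by lra.
    by apply: h; apply/andP; split; lra.
  have [r r0 h] := rg _ e0; exists r => // s s1.
  rewrite ifF; first exact: h.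
  by apply/negbTE; rewrite -leNgt; lra.
(* The point t = x now belongs to the first case: at the junction the left limit comes from [f],
   while right continuity comes from [g]. *)
have [tx|xt] := leP t x.
  have [r r0 h] := lf _ e0; exists r => // s s' s1 s2.
  by rewrite !ifT; [exact: h|lra|lra].
have [r r0 h] := lg _ e0; exists (Num.min r (t - x)).
  by rewrite lt_min r0 subr_gt0.
move=> s s'; rewrite ltrBlDl -ltrBlDr lt_min => /andP[/andP[s1 s2] s3].
rewrite ltrBlDl -ltrBlDr lt_min => /andP[/andP[s1' s2'] s3'].
rewrite !ifF; first by apply: h; apply/andP; split; lra.
  by apply/negbTE; rewrite -leNgt; lra.
by apply/negbTE; rewrite -leNgt; lra.
Qed.

Lemma cadlag_cst (c : R) : cadlag (fun=> c).
Proof. by move=> t; split => e e0; exists 1 => // *; rewrite subrr normr0. Qed.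

(** An e/3 argument. The radius is cut at 1 - t, respectively t, because closeness is assumed on
    [0, 1] only. *)
Lemma cadlag01_uniform_limit (F : nat -> R -> R) f :
  (forall n, cadlag (F n)) ->
  (forall e, 0 < e -> exists n, forall t, 0 <= t <= 1 -> `|F n t - f t| < e) ->
  cadlag01 f.
Proof.
move=> cF Ff; split => t t01.
  apply: rcontP => e e0; have e30 : 0 < e / 3 by rewrite divr_gt0.
  have [n Fn] := Ff _ e30; have [/(_ _ e30)[r r0 h] _] := cF n t.
  exists (Num.min r (1 - t)); first by rewrite lt_min r0 subr_gt0; lra.
  move=> s /andP[s1]; rewrite -ltrBlDl lt_min => /andP[s2 s3].
  have h1 : 0 <= t <= 1 by lra.
  have h2 : 0 <= s <= 1 by lra.
  have h3 : t < s < t + r by lra.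
  by have := Fn _ h1; have := Fn _ h2; have := h _ h3; rewrite !ltr_norml; lra.
apply: lcauchyP => e e0; have e30 : 0 < e / 3 by rewrite divr_gt0.
have [n Fn] := Ff _ e30; have [_ /(_ _ e30)[r r0 h]] := cF n t.
exists (Num.min r t); first by rewrite lt_min r0; lra.
move=> s s'; rewrite ltrBlDl -ltrBlDr lt_min => /andP[/andP[s1 s2] s3].
rewrite ltrBlDl -ltrBlDr lt_min => /andP[/andP[s1' s2'] s3'].
have h1 : 0 <= s' <= 1 by lra.
have h2 : 0 <= s <= 1 by lra.
have h3 : t - r < s < t by lra.
have h4 : t - r < s' < t by lra.
by have := Fn _ h1; have := Fn _ h2; have := h _ _ h3 h4; rewrite !ltr_norml; lra.
Qed.

Lemma xlnx_sqr (z : R) : 0 < z -> xlnx (z ^+ 2) = 2 * z * xlnx z.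
Proof. by move=> z0; rewrite !xlnxE lnXn// -mulr_natl expr2; ring. Qed.

(** On the negative axis the convention ln x = 0 for x <= 0 makes [xlnx] vanish. At 0 from the
    right, writing s as the square of its root q gives |s ln s| = 2 q |q ln q| <= 2 q, hence the
    radius (e / 2)^2. *)
Lemma continuous_xlnx : continuous (@xlnx R).
Proof.
move=> y; have [y0|y0|->] := ltgtP y 0.
- rewrite /continuous_at [X in _ --> X]xlnxE ln0 ?mulr0 ?ltW//.
  apply: cvg_near_cst; near=> s; rewrite xlnxE ln0 ?mulr0//; apply: ltW.
  by near: s; exact: lt_nbhsl.
- rewrite (_ : @xlnx R = (fun x => x * ln x)); last by apply/funext => x; rewrite xlnxE.
  by apply: cvgM; [exact: cvg_id|exact: (continuous_ln y0)].
- apply/cvgrPdist_lt => e e0; rewrite xlnxE mul0r.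
  exists (Num.min 1 ((e / 2) ^+ 2)) => /=.
    by rewrite lt_min ltr01 exprn_gt0// divr_gt0.
  move=> s /=; rewrite sub0r normrN lt_min => /andP[s1 s2].
  rewrite sub0r normrN; have [s0|s0] := leP s 0.
    by rewrite xlnxE ln0// mulr0 normr0.
  rewrite (gtr0_norm s0) in s1 s2.
  have q0 : 0 < Num.sqrt s by rewrite sqrtr_gt0.
  have q1 : Num.sqrt s <= 1 by rewrite -sqrtr1 ler_sqrt// ltW.
  have q2 : Num.sqrt s < e / 2.
    by rewrite -[ltRHS]gtr0_norm ?divr_gt0// -sqrtr_sqr ltr_sqrt// exprn_gt0// divr_gt0.
  rewrite -(sqr_sqrtr (ltW s0)) xlnx_sqr// normrM gtr0_norm ?mulr_gt0//.
  have /xlnx_bound : 0 <= Num.sqrt s <= 1 by rewrite ltW.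
  move=> /andP[b1 b2]; rewrite ler0_norm//.
  apply: (@le_lt_trans _ _ (2 * Num.sqrt s * 1)).
    by apply: ler_wpM2l; [rewrite mulr_ge0// ltW|lra].
  by lra.
Unshelve. all: by end_near. Qed.

Lemma cadlag_Cfun (u : word -> R) v : cadlag (Cfun u v).
Proof.
rewrite (_ : Cfun u v = fun t => if t < u v then
    Cx (u v) + 2 * (-1 + u v + xlnx (1 - t) - xlnx (1 - u v) - xlnx (u v - t))
  else Cx (u v) + u v * Q u (rcons v false)).
  apply: cadlag_glue; last exact: cadlag_cst.
  apply: continuous_cadlag => t.
  apply: cvgD; first exact: cvg_cst.
  apply: cvgM; first exact: cvg_cst.
  apply: cvgB; last first.
    apply: (@continuous_comp _ _ _ (fun x => u v - x) (@xlnx R)); last exact: continuous_xlnx.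
    by apply: cvgB; [exact: cvg_cst|exact: cvg_id].
  apply: cvgB; last exact: cvg_cst.
  apply: cvgD; first exact: cvg_cst.
  apply: (@continuous_comp _ _ _ (fun x => 1 - x) (@xlnx R)); last exact: continuous_xlnx.
  by apply: cvgB; [exact: cvg_cst|exact: cvg_id].
apply/funext => t; rewrite /Cfun /Ctx.
by case: ltP => _; rewrite ?mul1r ?mul0r ?mulr0 ?addr0.
Qed.

Lemma cadlag_Top x i h : 0 < x < 1 -> cadlag h -> cadlag (Top x i h).
Proof.
move=> /andP[x0 x1] ch; case: i.
  rewrite (_ : Top x true h = fun t => if t < x then 0 else
      (1 - x) * h ((1 - x)^-1 * t + - (x / (1 - x)))).
    apply: cadlag_glue; [exact: cadlag_cst|apply: cadlagZ].
    by apply: cadlag_affine => //; rewrite invr_gt0 subr_gt0.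
  apply/funext => t /=; case: ltP => xt; first by rewrite mul0r.
  by rewrite Top_right_arg// mul1r; congr (_ * h _); rewrite mulrBl [t / _]mulrC.
rewrite (_ : Top x false h = fun t => if t < x then x * h (x^-1 * t + 0) else 0).
  apply: cadlag_glue; [apply: cadlagZ|exact: cadlag_cst].
  by apply: cadlag_affine => //; rewrite invr_gt0.
apply/funext => t /=; case: ltP => xt; last by rewrite mul0r.
by rewrite Top_left_arg// mul1r addr0; congr (_ * h _); rewrite mulrC.
Qed.

Lemma cadlag_Rm (u : word -> R) v m : (forall v, 0 < u v < 1) -> cadlag (Rm u v m).
Proof.
move=> u01; elim: m v => [|m IHm] v.
  by rewrite (_ : Rm u v 0 = cst 0); [exact: cadlag_cst|apply/funext => t; rewrite Rm0].
rewrite (_ : Rm u v m.+1 = fun t => Cfun u v t +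
  (Top (u v) false (Rm u (rcons v false) m) t +
   Top (u v) true (Rm u (rcons v true) m) t)); last by apply/funext => t; rewrite RmS.
by apply: cadlagD; [exact: cadlag_Cfun|apply: cadlagD; exact: cadlag_Top].
Qed.

End cadlag_closure.

(** * Measurability *)

Section measurability_limn.
Context d (T : measurableType d) (R : realType).

(** All quantifiers range over [nat], so the set of convergence becomes a countable combination of
    measurable sets. *)
Lemma cvgn_cauchyE (h : nat -> R) : cvgn h <->
  forall k, exists N, forall m n, (N <= m)%N -> (N <= n)%N -> `|h m - h n| < k.+1%:R^-1.
Proof.
split=> [/cvg_ex[/= l /cvgrPdist_lt hl] k|hk].
  have : 0 < (k.+1%:R^-1 : R) by [].
  move: k.+1%:R^-1 => r r0; have /hl[N _ hN] : 0 < r / 2 by rewrite divr_gt0.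
  exists N => m n Nm Nn; have /= := hN m Nm; have /= := hN n Nn.
  rewrite !ltr_norml; lra.
apply: cauchy_cvg; apply/cauchyP => e e0.
have [k ke] : exists k, k.+1%:R^-1 < e.
  exists (Num.truncn e^-1); rewrite invf_plt ?posrE//.
  exact: truncnS_gt.
have [N hN] := hk k; exists (h N); exists N => // m /= Nm.
by rewrite /ball/= (lt_trans _ ke)// hN.
Qed.

Lemma measurable_cvgn_set (h : nat -> T -> R) :
  (forall n, measurable_fun setT (h n)) -> measurable [set w | cvgn (h ^~ w)].
Proof.
move=> mh.
rewrite [X in measurable X](_ : _ = \bigcap_k \bigcup_N \bigcap_m \bigcap_n
    [set w | ((N <= m)%N ==> ((N <= n)%N ==> (`|h m w - h n w| < k.+1%:R^-1)))]).
  apply: bigcapT_measurable => k; apply: bigcupT_measurable => N.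
  apply: bigcapT_measurable => m; apply: bigcapT_measurable => n.
  case: (N <= m)%N => /=; last by rewrite (_ : [set _ | _] = setT)//; apply/seteqP.
  case: (N <= n)%N => /=; last by rewrite (_ : [set _ | _] = setT)//; apply/seteqP.
  rewrite -[X in measurable X]setTI.
  have := @measurable_fun_ltr _ _ _ setT (fun w => `|h m w - h n w|) (fun=> k.+1%:R^-1).
  move=> /(_ _ _ measurableT [set true]); apply => //.
  by apply: measurableT_comp => //; exact: measurable_funB.
apply/seteqP; split => [w /= /cvgn_cauchyE hw k _|w hw].
  have [N hN] := hw k; exists N => // m _ n _ /=.
  by apply/implyP => Nm; apply/implyP => Nn; exact: hN.
apply/cvgn_cauchyE => k; have [N _ hN] := hw k I; exists N => m n Nm Nn.
by have /= := hN m I n I; rewrite Nm Nn.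
Qed.

Lemma measurable_fun_limn (h : nat -> T -> R) :
  (forall n, measurable_fun setT (h n)) -> measurable_fun setT (fun w => limn (h ^~ w)).
Proof.
move=> mh; pose A := [set w | cvgn (h ^~ w)].
(* [point] is the value of [limn] on divergent sequences, so the modified functions converge
   everywhere to the desired limit. *)
apply: (@measurable_fun_cvg _ _ _ _ (fun n w => if w \in A then h n w else point)).
  move=> n; apply: measurable_fun_ifT => //.
  apply: (measurable_fun_bool true); rewrite setTI.
  rewrite (_ : _ @^-1` _ = A); first exact: measurable_cvgn_set.
  by apply/seteqP; split => w /=; [move/set_mem|move/mem_set].
move=> w _; have [Aw|Aw] := pselect (A w); first by rewrite (mem_set Aw).
by rewrite (memNset Aw) (dvgP Aw); exact: cvg_cst.
Qed.

End measurability_limn.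

Section measurability.
Context (R : realType).

Lemma measurable_xlnx : measurable_fun setT (@xlnx R).
Proof.
rewrite (_ : @xlnx R = fun x => x * ln x); last by apply/funext => x; rewrite xlnxE.
by apply: measurable_funM => //; exact: measurable_ln.
Qed.

Lemma measurable_Cx : measurable_fun setT (@Cx R).
Proof.
apply: measurable_funD; [apply: measurable_funD => //|]; apply: measurable_funM => //.
  exact: measurable_xlnx.
by apply: (measurableT_comp measurable_xlnx); exact: measurable_funB.
Qed.

Context d (T : measurableType d) (U : word -> T -> R).
Hypothesis mU : forall v, measurable_fun setT (U v).

Let u w := fun v => U v w.

Let mu v : measurable_fun setT (fun w => u w v). Proof. exact: mU. Qed.

Let m1u v : measurable_fun setT (fun w => 1 - u w v).
Proof. by apply: measurable_funB => //; exact: measurable_cst. Qed.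

Lemma measurable_Qpart v m : measurable_fun setT (fun w => Qpart (u w) v m).
Proof.
elim: m v => [|m IHm] v.
  by under eq_fun do rewrite Qpart0; exact: measurable_cst.
under eq_fun do rewrite QpartS.
apply: measurable_funD; first exact: (measurableT_comp measurable_Cx).
by apply: measurable_funD; apply: measurable_funM; first [exact: mu|exact: m1u|exact: IHm].
Qed.

Lemma measurable_Q v : measurable_fun setT (fun w => Q (u w) v).
Proof. by apply: measurable_fun_limn => n; exact: measurable_Qpart. Qed.

Lemma measurable_Mp p v k : measurable_fun setT (fun w => Mp (u w) p v k).
Proof.
elim: k v => [|k IHk] v /=.
  apply: (measurableT_comp (measurable_powR p)).
  apply: measurable_funD => //; apply: measurable_funM => //.
  by apply: measurableT_comp => //; exact: measurable_Q.
by apply: measurable_funD; apply: measurable_funM => //;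
  apply: (measurableT_comp (measurable_powR p)); first [exact: mu|exact: m1u].
Qed.

Hypothesis U01 : forall v w, 0 < U v w < 1.

Lemma measurable_invr_pos (f : T -> R) : (forall w, 0 <= f w) ->
  measurable_fun setT f -> measurable_fun setT (fun w => (f w)^-1).
Proof.
move=> f0 mf; under eq_fun do rewrite -powR_inv1//.
exact: (measurableT_comp (measurable_powR (-1))).
Qed.

Lemma measurable_Cfun v (tau : T -> R) : measurable_fun setT tau ->
  measurable_fun setT (fun w => Cfun (u w) v (tau w)).
Proof.
move=> mtau; rewrite /Cfun /Ctx.
have mx (f : T -> R) : measurable_fun setT f -> measurable_fun setT (fun w => xlnx (f w)).
  exact: (measurableT_comp measurable_xlnx).
apply: measurable_funD; last first.
  apply: measurable_funM.
    by apply: measurable_fun_ifT => //; exact: measurable_fun_ler.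
  by apply: measurable_funM => //; exact: measurable_Q.
apply: measurable_funD; first exact: (measurableT_comp measurable_Cx).
apply: measurable_funM => //; apply: measurable_funM.
  by apply: measurable_fun_ifT => //; exact: measurable_fun_ltr.
by apply: measurable_funB; [apply: measurable_funB; [apply: measurable_funD|]|];
  try (apply: mx; exact: measurable_funB); exact: measurable_funD.
Qed.

(** The time [tau] has to be random: the recursion evaluates the children at t / U and (t - U) / (1
    - U). *)
Lemma measurable_Rm v m (tau : T -> R) : measurable_fun setT tau ->
  measurable_fun setT (fun w => Rm (u w) v m (tau w)).
Proof.
elim: m v tau => [|m IHm] v tau mtau.
  by under eq_fun do rewrite Rm0; exact: measurable_cst.
under eq_fun do rewrite RmS /=.
apply: measurable_funD; first exact: measurable_Cfun.
apply: measurable_funD; apply: measurable_funM.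
- by apply: measurable_fun_ifT => //; exact: measurable_fun_ltr.
- apply: measurable_funM => //; apply: IHm; apply: measurable_minr => //.
  apply: measurable_funM => //; apply: measurable_invr_pos => // w.
  by have /andP[/ltW] := U01 v w.
- by apply: measurable_fun_ifT => //; exact: measurable_fun_ler.
- apply: measurable_funM => //; apply: IHm; apply: measurable_maxr => //.
  apply: measurable_funM; first exact: measurable_funB.
  by apply: measurable_invr_pos => // w; rewrite /u; have := U01 v w; lra.
Qed.

End measurability.

(** * Moments *)

Section mp_cat.
Context (R : realType).

Lemma Mp_cat (u : word -> R) p v w k :
  Mp u p (v ++ w) k = Mp (fun x => u (v ++ x)) p w k.
Proof.
elim: k w => [|k IHk] w /=; first by rewrite -!Q_cat rcons_cat.
by rewrite -!IHk !rcons_cat.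
Qed.

End mp_cat.

Section bounded_expectation.
Context (R : realType) d (T : measurableType d) (P : probability T R).
Implicit Types f g : T -> R.

(** Unlike integrability, this class is closed under products, so expectations of polynomials in U,
    C(U) and the partial sums can be split freely. *)
Definition bmeas f := measurable_fun setT f /\ exists c, forall w, `|f w| <= c.

Lemma bmeasD f g : bmeas f -> bmeas g -> bmeas (fun w => f w + g w).
Proof.
move=> [mf [c fc]] [mg [c' gc]]; split; first exact: measurable_funD.
by exists (c + c') => w; rewrite (le_trans (ler_normD _ _))// lerD.
Qed.

Lemma bmeasM f g : bmeas f -> bmeas g -> bmeas (fun w => f w * g w).
Proof.
move=> [mf [c fc]] [mg [c' gc]]; split; first exact: measurable_funM.
by exists (c * c') => w; rewrite normrM ler_pM.
Qed.

Lemma bmeas_cst (c : R) : bmeas (fun=> c).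
Proof. by split; [exact: measurable_cst|exists `|c|]. Qed.

Lemma bmeas_integrable f : bmeas f -> P.-integrable setT (EFin \o f).
Proof. by move=> [mf [c fc]]; exact: probability_bounded_integrable fc. Qed.

Lemma bmeas_expectationD f g : bmeas f -> bmeas g ->
  (\int[P]_w (f w + g w)%:E = \int[P]_w (f w)%:E + \int[P]_w (g w)%:E)%E.
Proof.
move=> bf bg; under eq_integral do rewrite EFinD.
by rewrite integralD//; exact: bmeas_integrable.
Qed.

Lemma bmeas_expectationZ (c : R) f : bmeas f ->
  (\int[P]_w (c * f w)%:E = c%:E * \int[P]_w (f w)%:E)%E.
Proof.
move=> bf; under eq_integral do rewrite EFinM.
by rewrite integralZl//; exact: bmeas_integrable.
Qed.

End bounded_expectation.

Section moments.
Context (R : realType) d (T : measurableType d) (P : probability T R).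
Context (V : word -> T -> R).
Hypothesis mV : forall v, measurable_fun setT (V v).
Hypothesis indV : mutually_independent P V.
Hypothesis idV : forall v w B, measurable B -> P (V v @^-1` B) = P (V w @^-1` B).
Hypothesis V01 : forall v w, 0 < V v w < 1.
Hypothesis V_moment : forall v p, 0 < p ->
  (\int[P]_w (V v w `^ p)%:E = ((p + 1)^-1)%:E)%E.
Hypothesis onemV_moment : forall v p, 0 < p ->
  (\int[P]_w ((1 - V v w) `^ p)%:E = ((p + 1)^-1)%:E)%E.
Hypothesis V_Cx : forall v, (\int[P]_w (Cx (V v w))%:E = 0)%E.

Local Notation u w := (fun v => V v w).

(** Indexes v itself ([None]) and the subtree of the other child ([Some]): everything below v,
    inclusive, that is independent of the subtree at [rcons v i]. *)
Definition node_sibling v i : option word -> word :=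
  fun o => if o is Some x then rcons v (~~ i) ++ x else v.

Lemma node_sibling_inj v i : injective (node_sibling v i).
Proof.
have hn x : rcons v (~~ i) ++ x <> v.
  move=> /(congr1 size); rewrite size_cat size_rcons.
  by move=> /eqP; rewrite -[X in _ == X]addn0 addSnnS eqn_add2l.
move=> [x|] [y|] //=; last 2 first.
- by move/hn.
- by move/esym/hn.
by move=> /eqP; rewrite eqseq_cat// eqxx /= => /eqP ->.
Qed.

Lemma node_sibling_disjoint v i o x : node_sibling v i o <> rcons v i ++ x.
Proof.
case: o => [y|] /=.
  rewrite !cat_rcons => /eqP; rewrite eqseq_cat// eqxx /= eqseq_cons.
  by case: i.
move=> /(congr1 size); rewrite size_cat size_rcons.
by move=> /eqP; rewrite -[X in X == _]addn0 addSnnS eqn_add2l.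
Qed.

Lemma cat_inj (v : word) : injective (cat v).
Proof. by move=> x y /eqP; rewrite eqseq_cat// eqxx /= => /eqP. Qed.

Let node v i := subfam V (node_sibling v i).
Let tree v := subfam V (cat v).

Lemma Qpart_tree v m w : Qpart (u w) v m = Qpart (tree v w) [::] m.
Proof. by have := Qpart_cat (u w) v [::] m; rewrite cats0. Qed.

Lemma Q_tree v w : Q (u w) v = Q (tree v w) [::].
Proof. by have := Q_cat (u w) v [::]; rewrite cats0. Qed.

Lemma Mp_tree p v k w : Mp (u w) p v k = Mp (tree v w) p [::] k.
Proof. by have := Mp_cat (u w) p v [::] k; rewrite cats0. Qed.

Let u01 w : forall v, 0 < u w v < 1. Proof. by move=> v; exact: V01. Qed.

Lemma bmeas_V v : bmeas (V v).
Proof.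
by split => //; exists 1 => w; have := V01 v w; rewrite ler_norml; lra.
Qed.

Lemma bmeas_onemV v : bmeas (fun w => 1 - V v w).
Proof.
split; first by apply: measurable_funB => //; exact: measurable_cst.
by exists 1 => w; have := V01 v w; rewrite ler_norml; lra.
Qed.

Lemma bmeas_Cx v : bmeas (fun w => Cx (V v w)).
Proof.
split; first exact: (measurableT_comp (@measurable_Cx R)).
by exists 3 => w; apply: Cx_bound; have := V01 v w; lra.
Qed.

Lemma bmeas_Qpart v m : bmeas (fun w => Qpart (u w) v m).
Proof.
split; first exact: (measurable_Qpart mV).
by exists (3 * m%:R) => w; exact: Qpart_bound.
Qed.

Let mcoord (I : choiceType) (J : choiceType) (g : J -> I) :
  forall x, measurable_fun setT (fun f : paths R I => f (g x) : R).
Proof. by move=> x; exact: measurable_coord. Qed.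

(** The weight [F] may involve both U^v and the sibling subtree; the latter is needed for the cross
    term containing both children. *)
Lemma node_Qpart0 v i m (F : paths R (option word) -> R) :
  measurable_fun setT F -> bmeas (fun w => F (node v i w)) ->
  (\int[P]_w (Qpart (u w) (rcons v i) m)%:E = 0)%E ->
  (\int[P]_w (F (node v i w) * Qpart (u w) (rcons v i) m)%:E = 0)%E.
Proof.
move=> mF [_ [c Fc]] Q0; under eq_integral do rewrite Qpart_tree.
apply: (@subfam_expectationM0 _ _ _ P word V mV indV _ _ (node_sibling v i)
  (cat (rcons v i)) (@node_sibling_inj v i) (@cat_inj _)
  (@node_sibling_disjoint v i) F (fun f => Qpart f [::] m) (Num.max c (3 * m%:R))).
- exact: mF.
- exact: (measurable_Qpart (@mcoord word word id)).
- by move=> w; rewrite le_max Fc.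
- by move=> w; rewrite le_max -Qpart_tree Qpart_bound ?orbT.
- by under eq_integral do rewrite -Qpart_tree.
Qed.

Lemma node_ge0M v i (f : R -> R) (G : paths R word -> R) :
  measurable_fun setT f -> measurable_fun setT G ->
  (forall x, 0 <= f x) -> (forall x, 0 <= G x) ->
  (\int[P]_w (f (V v w) * G (tree (rcons v i) w))%:E =
   \int[P]_w (f (V v w))%:E * \int[P]_w (G (tree (rcons v i) w))%:E)%E.
Proof.
move=> mf mG f0 G0; under eq_integral do rewrite EFinM.
apply: (@subfam_ge0_expectationM _ _ _ P word V mV indV _ _ (node_sibling v i)
  (cat (rcons v i)) (@node_sibling_inj v i) (@cat_inj _)
  (@node_sibling_disjoint v i) (fun g => (f (g None))%:E) (fun g => (G g)%:E)).
- apply/measurable_EFinP; apply: (measurableT_comp mf); exact: measurable_coord.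
- exact/measurable_EFinP.
- by move=> x; rewrite lee_fin.
- by move=> x; rewrite lee_fin.
Qed.

Lemma expectation_Qpart v m : (\int[P]_w (Qpart (u w) v m)%:E = 0)%E.
Proof.
elim: m v => [|m IHm] v; first by rewrite integral0_eq// => w _; rewrite Qpart0.
under eq_integral do rewrite QpartS.
have bQ i := bmeas_Qpart (rcons v i) m.
have mN : measurable_fun setT (fun f : paths R (option word) => f None : R).
  exact: measurable_coord.
have m1N : measurable_fun setT (fun f : paths R (option word) => 1 - f None : R).
  by apply: measurable_funB => //; exact: measurable_cst.
rewrite bmeas_expectationD; [|exact: bmeas_Cx|by
  apply: bmeasD; apply: bmeasM => //; [exact: bmeas_V|exact: bmeas_onemV]].
rewrite V_Cx add0e bmeas_expectationD; [|by apply: bmeasM => //; exact: bmeas_V|by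
  apply: bmeasM => //; exact: bmeas_onemV].
rewrite (@node_Qpart0 v false m (fun f => f None)) ?IHm//; last exact: bmeas_V.
by rewrite (@node_Qpart0 v true m (fun f => 1 - f None)) ?IHm ?adde0//; exact: bmeas_onemV.
Qed.

(** Once the cross terms are gone, |C| <= 3 and E U^2 = E (1 - U)^2 = 1/3 give b_{m+1} <= 9 + (2/3)
    b_m for the second moments; 27 is the fixed point of this recursion. *)
Lemma expectation_Qpart_sqr v m : (\int[P]_w (Qpart (u w) v m ^+ 2)%:E <= 27%:E)%E.
Proof.
elim: m v => [|m IHm] v.
  by rewrite integral0_eq ?lee_fin// => w _; rewrite Qpart0 expr0n.
have bQ i := bmeas_Qpart (rcons v i) m.
have bV := bmeas_V v; have b1V := bmeas_onemV v; have bC := bmeas_Cx v.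
have mN : measurable_fun setT (fun f : paths R (option word) => f None : R).
  exact: measurable_coord.
have m1N : measurable_fun setT (fun f : paths R (option word) => 1 - f None : R).
  by apply: measurable_funB => //; exact: measurable_cst.
have mCN : measurable_fun setT (fun f : paths R (option word) => Cx (f None) : R).
  exact: (measurableT_comp (@measurable_Cx R)).
pose q i w := Qpart (u w) (rcons v i) m.
have bq i : bmeas (q i) by exact: bQ.
(* [S] collects the squares and [X] the cross terms, each of which has a centred factor. *)
pose S w := Cx (V v w) * Cx (V v w) + (V v w ^+ 2 * q false w ^+ 2 + (1 - V v w) ^+ 2 * q true w ^+ 2).
pose X w := (Cx (V v w) * V v w) * q false w +
  ((Cx (V v w) * (1 - V v w)) * q true w + (V v w * (1 - V v w) * q true w) * q false w).
have -> : (\int[P]_w (Qpart (u w) v m.+1 ^+ 2)%:E = \int[P]_w (S w + 2 * X w)%:E)%E.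
  by apply: eq_integral => w _; congr (_%:E); rewrite QpartS /S /X /q; ring.
have bsq (f : T -> R) : bmeas f -> bmeas (fun w => f w ^+ 2 : R).
  by move=> bf; under eq_fun do rewrite expr2; exact: bmeasM.
have bS1 : bmeas (fun w => V v w ^+ 2 * q false w ^+ 2).
  by apply: bmeasM; [exact: (bsq (V v))|exact: (bsq (q false))].
have bS2 : bmeas (fun w => (1 - V v w) ^+ 2 * q true w ^+ 2).
  by apply: bmeasM; [exact: (bsq (fun w => 1 - V v w))|exact: (bsq (q true))].
have bX1 : bmeas (fun w => (Cx (V v w) * V v w) * q false w).
  by apply: bmeasM => //; exact: bmeasM.
have bX2 : bmeas (fun w => (Cx (V v w) * (1 - V v w)) * q true w).
  by apply: bmeasM => //; exact: bmeasM.
have bX3 : bmeas (fun w => (V v w * (1 - V v w) * q true w) * q false w).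
  by apply: bmeasM => //; apply: bmeasM => //; exact: bmeasM.
have bX : bmeas X by apply: bmeasD => //; exact: bmeasD.
have bS12 : bmeas (fun w => V v w ^+ 2 * q false w ^+ 2 + (1 - V v w) ^+ 2 * q true w ^+ 2).
  exact: bmeasD.
have bCC : bmeas (fun w => Cx (V v w) * Cx (V v w)) by exact: bmeasM.
rewrite bmeas_expectationD; [|exact: bmeasD|apply: bmeasM => //; exact: bmeas_cst].
rewrite bmeas_expectationZ//.
rewrite (_ : (\int[P]_w (X w)%:E = 0)%E); last first.
  rewrite bmeas_expectationD//; last exact: bmeasD.
  rewrite bmeas_expectationD//.
  rewrite (@node_Qpart0 v false m (fun f => Cx (f None) * f None)) ?expectation_Qpart//; last 2 first.
  - exact: measurable_funM.
  - exact: bmeasM.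
  rewrite (@node_Qpart0 v true m (fun f => Cx (f None) * (1 - f None))) ?expectation_Qpart//; last 2 first.
  - exact: measurable_funM.
  - exact: bmeasM.
  (* In the term with both children, [q true] is read from the sibling coordinates of
     [node v false], so it belongs to the factor independent of [q false]. *)
  have qE w : q true w = Qpart (fun x => node v false w (Some x)) [::] m.
    by rewrite /q Qpart_tree.
  rewrite (_ : (fun w => _) = (fun w => (V v w * (1 - V v w) *
     Qpart (fun x => node v false w (Some x)) [::] m * q false w)%:E)); last first.
    by apply/funext => w; rewrite qE.
  rewrite (@node_Qpart0 v false m (fun f => f None * (1 - f None) * Qpart (fun x => f (Some x)) [::] m)) ?expectation_Qpart ?adde0//.
    apply: measurable_funM; first exact: measurable_funM.
    exact: (measurable_Qpart (@mcoord (option word) word Some)).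
  rewrite (_ : (fun w => _) = (fun w => V v w * (1 - V v w) * q true w)).
    by apply: bmeasM => //; exact: bmeasM.
  by apply/funext => w; rewrite qE.
rewrite mule0 adde0 bmeas_expectationD// bmeas_expectationD//.
have h (f : R -> R) i : measurable_fun setT f -> (forall x, 0 <= f x) ->
   (\int[P]_w (f (V v w))%:E = (3^-1)%:E)%E ->
   (\int[P]_w (f (V v w) * q i w ^+ 2)%:E <= 9%:E)%E.
  move=> mf f0 f3.
  rewrite (_ : (fun w => _) = (fun w => (f (V v w) * Qpart (tree (rcons v i) w) [::] m ^+ 2)%:E)); last first.
    by apply/funext => w; rewrite /q Qpart_tree.
  rewrite (@node_ge0M v i f (fun g => Qpart g [::] m ^+ 2))//; last 2 first.
  - by apply: measurable_funX; exact: (measurable_Qpart (@mcoord word word id)).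
  - by move=> x; exact: sqr_ge0.
  under [X in (_ * X)%E]eq_integral do rewrite -Qpart_tree.
  rewrite f3; apply: (le_trans (lee_wpmul2l _ (IHm _))).
    by rewrite lee_fin invr_ge0.
  by rewrite -EFinM lee_fin; lra.
have -> : (27%:E = 9%:E + (9%:E + 9%:E) :> \bar R)%E by rewrite -!EFinD; congr (_%:E); ring.
apply: leeD.
  rewrite -[leRHS]mule1 -(@probability_setT _ _ _ P) -integral_cst//.
  apply: ge0_le_integral => //.
  - by move=> w _; rewrite lee_fin -expr2 sqr_ge0.
  - by apply/measurable_EFinP; case: bCC.
  - move=> w _; rewrite lee_fin; apply: (le_trans (ler_norm _)); rewrite normrM.
    have : `|Cx (V v w)| <= 3 by apply: Cx_bound; have := V01 v w; lra.
    move=> h3; apply: (le_trans (ler_pM _ _ h3 h3)) => //; lra.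
apply: leeD.
  apply: (h (fun x => x ^+ 2)).
  - exact: measurable_funX.
  - by move=> x; exact: sqr_ge0.
  - under eq_integral => w _ do rewrite -powR_mulrn ?(ltW (andP (V01 v w)).1)//.
    by rewrite V_moment//; congr (_^-1%:E); ring.
apply: (h (fun x => (1 - x) ^+ 2)).
- by apply: measurable_funX; exact: measurable_funB.
- by move=> x; exact: sqr_ge0.
- under eq_integral => w _.
    rewrite -powR_mulrn; last by have := V01 v w; lra.
    over.
  by rewrite onemV_moment//; congr (_^-1%:E); ring.
Qed.

(** In the comparison with the lower limit, a divergent sequence of partial sums gives [Q] its
    default value 0, which is below any lower limit of squares. *)
Lemma expectation_Q_sqr v : (\int[P]_w (Q (u w) v ^+ 2)%:E <= 27%:E)%E.
Proof.
pose f m w : \bar R := (Qpart (u w) v m ^+ 2)%:E.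
have mf m : measurable_fun setT (f m).
  by apply/measurable_EFinP; apply: measurable_funX; exact: measurable_Qpart.
have f0 m w : (0 <= f m w)%E by rewrite lee_fin sqr_ge0.
apply: (@le_trans _ _ (\int[P]_w limn_einf (f ^~ w))%E).
  apply: ge0_le_integral => //.
  - by move=> w _; rewrite lee_fin sqr_ge0.
  - by apply/measurable_EFinP; apply: measurable_funX; exact: measurable_Q.
  - rewrite (_ : (fun w => _) = fun w => (- limn_esup (fun m => - f m w))%E).
      by apply: measurableT_comp => //; apply: measurable_fun_limn_esup => m; exact: measurableT_comp.
    by apply/funext => w; rewrite -limn_einfN; congr limn_einf; apply/funext => m; exact/esym/oppeK.
  move=> w _; rewrite /Q; have [cQ|dQ] := pselect (cvgn (Qpart (u w) v)).
    have cf : f ^~ w @ \oo --> (limn (Qpart (u w) v) ^+ 2)%:E.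
      apply: cvg_EFin; first by near=> m.
      rewrite [X in X @ _ --> _](_ : _ = (fun m => Qpart (u w) v m * Qpart (u w) v m)).
        by rewrite expr2; exact: cvgM.
      by apply/funext => m /=; rewrite expr2.
    by rewrite (cvg_limn_einf_sup cf).1.
  rewrite (dvgP dQ) expr0n/=.
  rewrite limn_einf_lim; apply: lime_ge; first exact: is_cvg_einfs.
  by near=> m; apply: le_ereal_inf_tmp => _ [k _ <-].
apply: (le_trans (fatou _ measurableT mf (fun m w _ => f0 m w))).
rewrite limn_einf_lim; apply: lime_le; first exact: is_cvg_einfs.
near=> m; apply: (@le_trans _ _ (\int[P]_w f m w)%E); last exact: expectation_Qpart_sqr.
by apply: ereal_inf_lbound; exists m => /=.
Unshelve. all: by end_near. Qed.

Lemma tree_law v (G : paths R word -> R) : measurable_fun setT G -> (forall x, 0 <= G x) ->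
  (\int[P]_w (G (tree v w))%:E = \int[P]_w (G (tree [::] w))%:E)%E.
Proof.
move=> mG G0; apply: (@subfam_ge0_law _ _ _ P word V mV indV idV _ (cat v) (cat [::])
  (fun g => (G g)%:E) (@cat_inj _) (@cat_inj _)).
- exact/measurable_EFinP.
- by move=> x; rewrite lee_fin.
Qed.

(** All terms are nonnegative, so this holds in the extended reals even if the moment at level 0 is
    infinite. Each level contributes E U^p + E (1 - U)^p. *)
Lemma expectation_Mp v p k : 0 < p -> (\int[P]_w (Mp (u w) p v k)%:E =
  ((2 / (p + 1)) ^+ k)%:E * \int[P]_w (Mp (u w) p [::] 0)%:E)%E.
Proof.
move=> p0.
(* [G] is opaque: otherwise unification unfolds the recursion of [Mp]. *)
have [G [mG G0 GE]] : exists G : nat -> paths R word -> R,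
    [/\ forall j, measurable_fun setT (G j), forall j f, 0 <= G j f
      & forall v j w, Mp (u w) p v j = G j (tree v w)].
  exists (fun j f => Mp f p [::] j); split.
  - by move=> j; exact: (measurable_Mp (@mcoord word word id)).
  - by move=> j f; exact: Mp_ge0.
  - by move=> *; exact: Mp_tree.
pose e v' j := (\int[P]_w (G j (tree v' w))%:E)%E.
have eE v' j : (\int[P]_w (Mp (u w) p v' j)%:E = e v' j)%E.
  by apply: eq_integral => w _; congr (_%:E); exact: GE.
rewrite (eE v k) (eE [::] 0%N).
have eS v' j : e v' j.+1 = (\int[P]_w (V v' w `^ p * G j (tree (rcons v' false) w) +
    (1 - V v' w) `^ p * G j (tree (rcons v' true) w))%:E)%E.
  apply: eq_integral => w _; congr (_%:E).
  by rewrite -GE; congr (_ * _ + _ * _); exact: GE.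
have e0 v' : e v' 0%N = e [::] 0%N by exact: tree_law.
have mGt v' j : measurable_fun setT (fun w => G j (tree v' w)).
  by apply: (measurableT_comp (mG j)); exact: measurable_subfam.
elim: k v => [|k IHk] v; first by rewrite expr0 mul1e.
have h (f : R -> R) i : measurable_fun setT f -> (forall x, 0 <= f x) ->
   (\int[P]_w (f (V v w))%:E = ((p + 1)^-1)%:E)%E ->
   (\int[P]_w (f (V v w) * G k (tree (rcons v i) w))%:E =
     ((p + 1)^-1)%:E * (((2 / (p + 1)) ^+ k)%:E * e [::] 0%N))%E.
  by move=> mf f0 fp; rewrite -(IHk (rcons v i)) -fp node_ge0M.
rewrite eS; under eq_integral do rewrite EFinD.
rewrite ge0_integralD//; last 4 first.
- by move=> w _; rewrite lee_fin mulr_ge0 ?powR_ge0.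
- apply/measurable_EFinP/measurable_funM => //.
  exact: (measurableT_comp (measurable_powR p)).
- by move=> w _; rewrite lee_fin mulr_ge0 ?powR_ge0.
- apply/measurable_EFinP/measurable_funM => //.
  by apply: (measurableT_comp (measurable_powR p)); case: (bmeas_onemV v).
rewrite (h (fun x => x `^ p) false)//; last 2 first.
- by move=> x; exact: powR_ge0.
- exact: V_moment.
rewrite (h (fun x => (1 - x) `^ p) true)//; last 3 first.
- by apply: (measurableT_comp (measurable_powR p)); exact: measurable_funB.
- by move=> x; exact: powR_ge0.
- exact: onemV_moment.
rewrite -ge0_muleDl ?lee_fin ?invr_ge0 ?addr_ge0 ?ltW// muleA -EFinD -EFinM; congr (_%:E * _)%E.
by rewrite exprS; ring.
Qed.

Lemma expectation_VQ v i p : 0 < p ->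
  (\int[P]_w ((V v w * `|Q (u w) (rcons v i)|) `^ p)%:E =
   ((p + 1)^-1)%:E * \int[P]_w (`|Q (u w) [::]| `^ p)%:E)%E.
Proof.
move=> p0.
have [G [mG G0 GE]] : exists G : paths R word -> R,
    [/\ measurable_fun setT G, forall f, 0 <= G f
      & forall v w, `|Q (u w) v| `^ p = G (tree v w)].
  exists (fun f => `|Q f [::]| `^ p); split.
  - apply: (measurableT_comp (measurable_powR p)); apply: measurableT_comp => //.
    exact: (measurable_Q (@mcoord word word id)).
  - by move=> f; exact: powR_ge0.
  - by move=> v' w; congr (`|_| `^ p); exact: (Q_tree v' w).
have VE : (\int[P]_w ((V v w * `|Q (u w) (rcons v i)|) `^ p)%:E =
    \int[P]_w (V v w `^ p * G (tree (rcons v i) w))%:E)%E.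
  apply: eq_integral => w _; rewrite -GE powRM//.
  by have /andP[/ltW] := V01 v w.
rewrite VE (@node_ge0M v i (fun x => x `^ p))//; last by move=> x; exact: powR_ge0.
rewrite V_moment// tree_law//; congr (_ * _)%E.
by apply: eq_integral => w _; rewrite -GE.
Qed.

End moments.

(** * Integrals against the uniform law *)

Section unit_interval_integrals.
Context (R : realType).
Local Notation mu := (@lebesgue_measure R).

Let continuous_xlnx_onem : continuous (fun x : R => xlnx (1 - x)).
Proof.
move=> x; apply: (@continuous_comp R R R (fun x => 1 - x) (@xlnx R) x).
  by apply: cvgB; [exact: cvg_cst|exact: cvg_id].
exact: continuous_xlnx.
Qed.

Lemma continuous_Cx : continuous (@Cx R).
Proof.
move=> x; apply: cvgD.
  apply: cvgD; first exact: cvg_cst.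
  by apply: cvgM; [exact: cvg_cst|exact: continuous_xlnx].
by apply: cvgM; [exact: cvg_cst|exact: continuous_xlnx_onem].
Qed.

(** A primitive of 2 y ln y is y^2 ln y - y^2 / 2, used at y = x and y = 1 - x. Writing it with
    [xlnx] makes continuity at both endpoints visible; its values at 0 and 1 are both 1/2. *)
Let Cx_primitive (x : R) : R :=
  x + x * xlnx x - x ^+ 2 / 2 - (1 - x) * xlnx (1 - x) + (1 - x) ^+ 2 / 2.

Let continuous_Cx_primitive : continuous Cx_primitive.
Proof.
have c1 : continuous (fun x : R => 1 - x).
  by move=> x; apply: cvgB; [exact: cvg_cst|exact: cvg_id].
move=> x; apply: cvgD; last first.
  apply: cvgM; last exact: cvg_cst.
  rewrite expr2; under eq_fun do rewrite expr2.
  by apply: cvgM; exact: c1.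
apply: cvgB; last first.
  by apply: cvgM; [exact: c1|exact: continuous_xlnx_onem].
apply: cvgB; last first.
  apply: cvgM; last exact: cvg_cst.
  rewrite expr2; under eq_fun do rewrite expr2.
  by apply: cvgM; exact: cvg_id.
apply: cvgD; first exact: cvg_id.
by apply: cvgM; [exact: cvg_id|exact: continuous_xlnx].
Qed.

Let is_derive_Cx_primitive (x : R) : 0 < x < 1 -> is_derive x 1 Cx_primitive (Cx x).
Proof.
move=> /andP[x0 x1].
have dl := is_derive1_ln x0.
have d1 : is_derive x 1 (fun y : R => 1 - y) (-1).
  by apply: is_derive_eq; ring.
have dl1 : is_derive x 1 (fun y : R => ln (1 - y)) (- (1 - x)^-1).
  have y0 : 0 < 1 - x by lra.
  have dy := is_derive1_ln y0.
  have := @is_derive1_comp _ (@ln R) (fun y : R => 1 - y) x _ _ dy d1.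
  by rewrite mulrN1.
rewrite (_ : Cx_primitive = fun y : R => y + y * (y * ln y) - y ^+ 2 / 2 -
    (1 - y) * ((1 - y) * ln (1 - y)) + (1 - y) ^+ 2 / 2); last first.
  by apply/funext => y; rewrite /Cx_primitive !xlnxE.
apply: is_derive_eq; rewrite /Cx !xlnxE /GRing.scale /=.
by field; apply/andP; split; rewrite gt_eqF//; lra.
Qed.

Lemma integral_Cx01 : (\int[mu]_(x in `[0%R, 1%R]) (Cx x)%:E = 0)%E.
Proof.
rewrite (@continuous_FTC2 _ _ Cx_primitive)//.
- rewrite /Cx_primitive -EFinB; congr (_%:E).
  by rewrite subrr subr0 !xlnxE ln1; field.
- exact: continuous_subspaceT continuous_Cx.
- split.
  + by move=> x; rewrite in_itv/= => /is_derive_Cx_primitive[].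
  + exact/cvg_at_right_filter/continuous_Cx_primitive.
  + exact/cvg_at_left_filter/continuous_Cx_primitive.
- move=> x; rewrite in_itv/= => /is_derive_Cx_primitive dx.
  by rewrite derive1E derive_val.
Qed.

Let derivable_cvg (f : R -> R) x : derivable f x 1 -> f y @[y --> x] --> f x.
Proof. by move=> /derivable1_diffP/differentiable_continuous. Qed.

Lemma continuous_powR_within (p : R) : 0 < p ->
  {within `[0, 1], continuous (fun x : R => x `^ p)}.
Proof.
move=> p0; apply: derivable_oo_LRcontinuous_within; split.
- move=> x; rewrite in_itv/= => /andP[x0 _].
  by have [] := is_derive1_powR p x0.
- by rewrite powR0 ?gt_eqF//; exact: powR_cvg0.
- apply: cvg_at_left_filter; apply: derivable_cvg.
  by have [] := is_derive1_powR p (@ltr01 R).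
Qed.

Lemma integral_powR01 (p : R) : 0 < p ->
  (\int[mu]_(x in `[0%R, 1%R]) (x `^ p)%:E = ((p + 1)^-1)%:E)%E.
Proof.
move=> p0; have p1 : 0 < p + 1 by lra.
have d (x : R) : 0 < x -> is_derive x 1 (fun x => (p + 1)^-1 * x `^ (p + 1)) (x `^ p).
  move=> x0; have dx := is_derive1_powR (p + 1) x0.
  apply: is_derive_eq; rewrite /GRing.scale /= mulrA mulVf ?gt_eqF// mul1r.
  by rewrite addrK.
rewrite (@continuous_FTC2 _ _ (fun x => (p + 1)^-1 * x `^ (p + 1)))//.
- by rewrite powR1 powR0 ?gt_eqF// mulr0 mulr1 sube0.
- exact: continuous_powR_within.
- split.
  + by move=> x; rewrite in_itv/= => /andP[/d[]].
  + apply: cvgM; first exact: cvg_cst.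
    by rewrite powR0 ?gt_eqF//; exact: powR_cvg0.
  + apply: cvg_at_left_filter; apply: (derivable_cvg (f := fun x => _ * _)).
    by have [] := d _ (@ltr01 R).
- move=> x; rewrite in_itv/= => /andP[/d dx _].
  by rewrite derive1E derive_val.
Qed.

Lemma integral_onem_powR01 (p : R) : 0 < p ->
  (\int[mu]_(x in `[0%R, 1%R]) ((1 - x) `^ p)%:E = ((p + 1)^-1)%:E)%E.
Proof.
move=> p0; rewrite -(integral_powR01 p0).
have := @integration_by_substitution_onem R (fun x => x `^ p) 1.
rewrite lexx ler01 => -> //; last exact: continuous_powR_within.
rewrite -[RHS]/(\int[mu]_(x in `[(1 - 1)%R, 1%R]) ((1 - x) `^ p)%:E)%E.
by rewrite subrr.
Qed.

End unit_interval_integrals.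

Section clamped_uniform.
Context (R : realType) d (T : measurableType d) (P : probability T R).

(* Values outside ]0, 1[ have probability 0 and are sent to 1/2. *)
Definition clamp01 (x : R) : R := if 0 < x < 1 then x else 2^-1.

Lemma clamp01_itv x : 0 < clamp01 x < 1.
Proof. by rewrite /clamp01; case: ifP => // _; lra. Qed.

Lemma measurable_clamp01 : measurable_fun setT clamp01.
Proof.
apply: measurable_fun_ifT => //.
by apply: measurable_and; exact: measurable_fun_ltr.
Qed.

Context (X : {RV P >-> R}).
Hypothesis unifX : forall A : set R, measurable A ->
  distribution P X A = uniform_prob (@ltr01 R) A.

Lemma clamp01_ae : {ae P, forall w, clamp01 (X w) = X w}.
Proof.
exists (X @^-1` (~` `]0, 1[%classic)); split.
- by rewrite -[X in measurable X]setTI; apply: measurable_funPT => //; exact: measurableC.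
- rewrite [LHS](_ : _ = distribution P X (~` `]0, 1[%classic))//.
  rewrite unifX; last exact: measurableC.
  rewrite /uniform_prob integral_uniform_pdf; apply: null_set_integral => //.
  + by apply: measurableI => //; exact: measurableC.
  + by apply/measurable_EFinP/measurable_funTS; exact: measurable_uniform_pdf.
  (* Within [0, 1], which carries the uniform law, only the two endpoints are altered by
     clamping. *)
  + have sub : ~` `]0, 1[%classic `&` `[0, 1]%classic `<=` [set 0; 1 : R].
      move=> x /= []; rewrite !in_itv/= => /negP; rewrite negb_and -!leNgt => + /andP[x0 x1].
      by move=> /orP[?|?]; [left|right]; lra.
    apply: countable_lebesgue_measure0; apply: (sub_countable (subset_card_le sub)).
    exact/finite_set_countable/finite_set2.
- move=> w /= h; rewrite in_itv/= => w01; apply: h.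
  by rewrite /clamp01 w01.
Qed.

Lemma expectation_clamp01 (g : R -> R) : measurable_fun setT g ->
  (forall x, 0 <= g x) ->
  (\int[P]_w (g (clamp01 (X w)))%:E = \int[lebesgue_measure]_(x in `[0%R, 1%R]) (g x)%:E)%E.
Proof.
move=> mg g0.
have mEg : measurable_fun setT (EFin \o g) by exact/measurable_EFinP.
transitivity (\int[P]_w (g (X w))%:E)%E.
  apply: ae_eq_integral => //.
  - apply/measurable_EFinP; apply: (measurableT_comp mg).
    exact: (measurableT_comp measurable_clamp01).
  - by apply/measurable_EFinP; exact: (measurableT_comp mg).
  - by apply: filterS clamp01_ae => w /= -> _.
(* [uniform_prob] lives on [measurableTypeR R], whose display differs from that
   of the canonical measurable structure on [R] used by [distribution]. *)
pose Y : T -> measurableTypeR R := X.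
have mY : measurable_fun setT Y by move=> mT B mB; exact: (measurable_funP X mT B mB).
have mEg' : measurable_fun setT (EFin \o g : measurableTypeR R -> \bar R).
  by move=> mT B mB; exact: (mEg mT B mB).
transitivity (\int[pushforward P Y]_x (g x)%:E)%E.
  by rewrite (ge0_integral_pushforward mY)// => y _; rewrite lee_fin.
transitivity (\int[uniform_prob (@ltr01 R)]_x (g x)%:E)%E.
  by apply: eq_measure_integral => A mA _; exact: unifX.
rewrite integral_uniform//.
by rewrite subr0 invr1 mul1e.
Qed.

End clamped_uniform.

(** * Domination of integrals, geometric increments and the sup norm *)

Section dominated_integral.
Context d (T : measurableType d) (R : realType) (P : {measure set T -> \bar R}).

(* The integral of a nonmeasurable [f] is still the supremum of the integrals of
   the simple functions below [f], hence monotone. *)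
Lemma le_integral_ae_dominated (f g : T -> \bar R) :
  (forall w, 0 <= f w)%E -> (forall w, 0 <= g w)%E -> measurable_fun setT g ->
  {ae P, forall w, (f w <= g w)%E} -> (\int[P]_w f w <= \int[P]_w g w)%E.
Proof.
move=> f0 g0 mg [N [mN N0 sub]].
pose g' w : \bar R := if w \in N then +oo%E else g w.
have mg' : measurable_fun setT g'.
  apply: measurable_fun_ifT => //; apply: (measurable_fun_bool true).
  rewrite setTI (_ : _ @^-1` _ = N)//.
  by apply/seteqP; split => w /=; [move/set_mem|move/mem_set].
have g'0 w : (0 <= g' w)%E by rewrite /g'; case: ifP.
have fg' w : (f w <= g' w)%E.
  rewrite /g'; case: ifPn => [_|/negP wN]; first exact: leey.
  by apply: contrapT => fg; apply: wN; apply/mem_set; exact: sub.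
apply: (@le_trans _ _ (\int[P]_w g' w)%E).
  rewrite !ge0_integralTE//; apply: ereal_sup_le => _ [h /= hf <-].
  by exists h => // x; exact: (le_trans (hf x)).
rewrite (@ae_eq_integral _ _ _ P setT g g')//.
exists N; split => // w /= h; apply: contrapT => wN; apply: h => _.
by rewrite /g' memNset.
Qed.

End dominated_integral.

Section geometric_increments.
Context (R : realType) (a : nat -> R) (K : R).
Hypothesis aK : forall k, `|a k.+1 - a k| <= K * (8 / 9) ^+ k.

(** The factor 9 is the sum of the geometric series with ratio 8/9. *)
Lemma geometric_increments_le m n : (m <= n)%N ->
  `|a n - a m| <= 9 * K * (8 / 9) ^+ m.
Proof.
move=> mn.
have K0 : 0 <= K by have := aK 0; rewrite expr0 mulr1; exact: le_trans.
have q0 j : 0 <= (8 / 9) ^+ j :> R by rewrite exprn_ge0//; lra.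
(* The telescoped form is sharp enough to be preserved by induction on n - m. *)
suff : `|a n - a m| <= 9 * K * ((8 / 9) ^+ m - (8 / 9) ^+ n).
  by move=> /le_trans; apply; rewrite ler_wpM2l ?mulr_ge0// gerBl.
rewrite -(subnKC mn); elim: (n - m)%N => [|j IHj].
  by rewrite addn0 !subrr mulr0 normr0.
rewrite addnS -(subrK (a (m + j)%N) (a (m + j).+1)) -addrA.
apply: (le_trans (ler_normD _ _)); apply: (le_trans (lerD (aK _) IHj)).
by rewrite exprS le_eqVlt; apply/orP; left; apply/eqP; field.
Qed.

Lemma cvgn_geometric_increments : cvgn a.
Proof.
apply/cvgn_cauchyE => k; have : 0 < (k.+1%:R^-1 : R) by [].
move: k.+1%:R^-1 => r r0; have r20 : 0 < r / 2 by rewrite divr_gt0.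
have q1 : `|8 / 9 : R| < 1 by rewrite ger0_norm; lra.
have /cvgrPdist_lt/(_ _ r20)[N _ hN] := @cvg_geometric R (9 * K) (8 / 9) q1.
exists N => m n Nm Nn; have := geometric_increments_le Nm.
have := geometric_increments_le Nn; have /= := hN N (leqnn N).
by rewrite sub0r normrN !ltr_norml !ler_norml; lra.
Qed.

Lemma limn_geometric_increments m : `|limn a - a m| <= 9 * K * (8 / 9) ^+ m.
Proof.
have ca := cvgn_geometric_increments.
have h : `|a n - a m| @[n --> \oo] --> `|limn a - a m|.
  by apply: cvg_norm; apply: cvgB => //; exact: cvg_cst.
apply: (ler_cvg_to h (cvg_cst _)); exists m => // n /= mn.
exact: geometric_increments_le.
Qed.

End geometric_increments.

Section supnorm_bounds.
Context (R : realType).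
Implicit Types f : R -> R.

Lemma supnorm_le f c : (forall t, 0 <= t <= 1 -> `|f t| <= c) ->
  (supnorm f <= c%:E)%E.
Proof.
move=> fc; apply: ge_ereal_sup => _ [t /= t01 <-]; rewrite lee_fin; apply: fc.
by rewrite in_itv/= in t01.
Qed.

Lemma supnorm_ge0 f : (0 <= supnorm f)%E.
Proof.
apply: (@le_trans _ _ `|f 0|%:E); first by rewrite lee_fin.
by apply: ereal_sup_ubound; exists 0 => //=; rewrite in_itv/= lexx ler01.
Qed.

Lemma supnorm_poweR_le f c p : 0 <= p -> (forall t, 0 <= t <= 1 -> `|f t| <= c) ->
  (supnorm f `^ p <= (c `^ p)%:E)%E.
Proof.
move=> p0 fc; rewrite -poweR_EFin; apply: gt0_ler_poweR => //; last exact: supnorm_le.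
  by rewrite in_itv/= supnorm_ge0 leey.
rewrite in_itv/= leey lee_fin andbT; apply: (le_trans (normr_ge0 (f 0))).
by apply: fc; rewrite lexx ler01.
Qed.

End supnorm_bounds.

(** * The limit process *)

Section limit.
Context (R : realType) d (T : measurableType d) (P : probability T R).
Context (V : word -> T -> R).
Hypothesis mV : forall v, measurable_fun setT (V v).
Hypothesis indV : mutually_independent P V.
Hypothesis idV : forall v w B, measurable B -> P (V v @^-1` B) = P (V w @^-1` B).
Hypothesis V01 : forall v w, 0 < V v w < 1.
Hypothesis V_moment : forall v p, 0 < p ->
  (\int[P]_w (V v w `^ p)%:E = ((p + 1)^-1)%:E)%E.
Hypothesis onemV_moment : forall v p, 0 < p ->
  (\int[P]_w ((1 - V v w) `^ p)%:E = ((p + 1)^-1)%:E)%E.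
Hypothesis V_Cx : forall v, (\int[P]_w (Cx (V v w))%:E = 0)%E.

Local Notation u w := (fun v => V v w).

Let u01 w : forall v, 0 < u w v < 1. Proof. by move=> v; exact: V01. Qed.

Let M v k w := Mp (u w) 2 v k.

Let M_ge0 v k w : 0 <= M v k w. Proof. exact: Mp_ge0. Qed.

Let measurable_M v k : measurable_fun setT (M v k).
Proof. exact: measurable_Mp. Qed.

Let expectation_M v k : (\int[P]_w (M v k w)%:E =
  ((2 / 3) ^+ k)%:E * \int[P]_w (M [::] 0%N w)%:E)%E.
Proof.
have -> : 2 / 3 = 2 / (2 + 1) :> R by congr (_ / _); ring.
exact: expectation_Mp.
Qed.

Let Rdiff_sqr_le v k w t : 0 <= t <= 1 -> Rdiff (u w) v k t ^+ 2 <= M v k w.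
Proof.
move=> t01; rewrite -[leLHS]ger0_norm ?sqr_ge0// normrX -powR_mulrn//.
by apply: Rdiff_powR_bound.
Qed.

Let M0_lty : (\int[P]_w (M [::] 0%N w)%:E < +oo)%E.
Proof.
(* From (a + b)^2 <= 2 a^2 + 2 b^2 with a = 8, and U <= 1. *)
apply: (@le_lt_trans _ _ (\int[P]_w (128 + 2 * Q (u w) [:: false] ^+ 2)%:E)%E).
  apply: ge0_le_integral => //.
  - by move=> w _; rewrite lee_fin M_ge0.
  - exact/measurable_EFinP.
  - apply/measurable_EFinP; apply: measurable_funD => //.
    by apply: measurable_funM => //; apply: measurable_funX; exact: measurable_Q.
  move=> w _; rewrite lee_fin /M /= powR_mulrn; last first.
    by rewrite addr_ge0// mulr_ge0//; have /andP[/ltW] := V01 [::] w.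
  rewrite -[Q _ _ ^+ 2]ger0_norm ?sqr_ge0// normrX.
  have q0 := normr_ge0 (Q (u w) [:: false]).
  move: (`|_|) q0 => q q0.
  have h : (V [::] w * q) ^+ 2 <= q ^+ 2.
    rewrite ler_pXn2r// ?nnegrE//; first by rewrite ler_piMl//; have := V01 [::] w; lra.
    by rewrite mulr_ge0//; have := V01 [::] w; lra.
  have := sqr_ge0 (8 - V [::] w * q); move: (V [::] w * q) h => r h; nra.
under eq_integral do rewrite EFinD EFinM.
rewrite ge0_integralD//; last 2 first.
- by move=> w _; rewrite -EFinM lee_fin mulr_ge0// sqr_ge0.
- under eq_fun do rewrite -EFinM; apply/measurable_EFinP; apply: measurable_funM => //.
  by apply: measurable_funX; exact: measurable_Q.
rewrite integral_cst// ge0_integralZl//; last 2 first.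
- by apply/measurable_EFinP; apply: measurable_funX; exact: measurable_Q.
- by move=> w _; rewrite lee_fin sqr_ge0.
rewrite [X in (_ * X + _)%E](_ : _ = 1%E); last exact: probability_setT.
rewrite mule1 lte_add_pinfty ?ltry// lte_mul_pinfty//.
exact: (le_lt_trans (expectation_Q_sqr mV indV V01 V_moment onemV_moment V_Cx _)) (ltry _).
Qed.

(* The weights (9/8)^(2k) beat the decay (2/3)^k of [expectation_M]; finiteness of
   this sum gives |R_(k+1) - R_k| = O((8/9)^k) uniformly on [0, 1]. *)
Let S v w : \bar R := (\sum_(k <oo) ((81 / 64) ^+ k * M v k w)%:E)%E.

Let term_ge0 v k w : (0 <= ((81 / 64) ^+ k * M v k w)%:E)%E.
Proof. by rewrite lee_fin mulr_ge0// exprn_ge0//; lra. Qed.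

Let S_ge0 v w : (0 <= S v w)%E.
Proof. exact: nneseries_ge0. Qed.

Let measurable_S v : measurable_fun setT (S v).
Proof.
apply: ge0_emeasurable_sum => // k _.
by apply/measurable_EFinP; exact: measurable_funM.
Qed.

Let expectation_S v : (\int[P]_w S v w < +oo)%E.
Proof.
rewrite integral_nneseries//; last first.
  by move=> k; apply/measurable_EFinP; exact: measurable_funM.
have M0_ge0 : (0 <= \int[P]_w (M [::] 0%N w)%:E)%E.
  by apply: integral_ge0 => w _; rewrite lee_fin.
have M0_fin : (\int[P]_w (M [::] 0%N w)%:E)%E \is a fin_num by rewrite ge0_fin_numE.
move: M0_ge0 M0_fin; case: (\int[P]_w (M [::] 0%N w)%:E)%E (expectation_M v) => // e eM.
rewrite lee_fin => e0 _.
(* 27/32 = (81/64) (2/3) is the ratio of the series of expectations. *)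
have q1 : 27 / 32 != 1 :> R by rewrite lt_eqF//; lra.
have tE k : (\int[P]_w ((81 / 64) ^+ k * M v k w)%:E = (geometric e (27 / 32) k)%:E)%E.
  under eq_integral do rewrite EFinM.
  rewrite ge0_integralZl//; last 2 first.
  - exact/measurable_EFinP.
  - by move=> w _; rewrite lee_fin M_ge0.
  rewrite eM -!EFinM /= mulrA -exprMn; congr (_%:E).
  by rewrite mulrC; congr (_ * _ ^+ _); field.
rewrite (eq_eseriesr (g := fun k => (geometric e (27 / 32) k)%:E)); last by move=> k _; exact: tE.
apply: (@le_lt_trans _ _ (e / (1 - 27 / 32))%:E); last exact: ltry.
apply: lime_le.
  by apply: is_cvg_nneseries => k _ _; rewrite lee_fin /= mulr_ge0// exprn_ge0//; lra.
near=> n; rewrite sumEFin lee_fin.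
rewrite (_ : \sum_(_ <= _ < _) _ = e * (1 - (27 / 32) ^+ n) / (1 - 27 / 32)); last first.
  exact: (congr1 (@^~ n) (@geometric_seriesE R e (27 / 32) q1)).
rewrite ler_pM2r ?invr_gt0; last by lra.
by rewrite ler_piMr// gerBl exprn_ge0//; lra.
Unshelve. all: by end_near. Qed.

Let S_fin v : {ae P, forall w, (S v w < +oo)%E}.
Proof.
have iS : P.-integrable setT (S v).
  apply/integrableP; split; first exact: measurable_S.
  by under eq_integral do rewrite gee0_abs//; exact: expectation_S.
apply: filterS (integrable_ae measurableT iS) => w /(_ I).
by rewrite ge0_fin_numE.
Qed.

Let K v w := Num.sqrt (fine (S v w)).

(** A single term of the series [S] already bounds the squared increment by (64/81)^k [S]; the rate
    follows by taking square roots. *)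
Let Rm_increment v w t k : (S v w < +oo)%E -> 0 <= t <= 1 ->
  `|Rm (u w) v k.+1 t - Rm (u w) v k t| <= K v w * (8 / 9) ^+ k.
Proof.
move=> Soo t01; rewrite !Rm_Rdiff big_ord_recr /= addrAC subrr add0r.
have Sf : S v w \is a fin_num by rewrite ge0_fin_numE.
have h : (81 / 64) ^+ k * M v k w <= fine (S v w).
  rewrite -lee_fin fineK// (le_trans _ (nneseries_lim_ge k.+1 _))//.
  rewrite big_nat_recr//= leeDr//; exact: sume_ge0.
rewrite -(@ler_pXn2r _ 2) ?nnegrE//; last first.
  by rewrite mulr_ge0 ?sqrtr_ge0// exprn_ge0//; lra.
rewrite -normrX ger0_norm ?sqr_ge0// (le_trans (Rdiff_sqr_le _ _ _ t01))//.
rewrite exprMn sqr_sqrtr ?fine_ge0// -exprM mulnC exprM.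
rewrite (_ : (8 / 9) ^+ 2 = (81 / 64)^-1); last by field.
by rewrite exprVn ler_pdivlMr ?exprn_gt0// mulrC.
Qed.

Let L v w t := limn (fun m => Rm (u w) v m t).

Let Rm_cvg v w t : (S v w < +oo)%E -> 0 <= t <= 1 ->
  Rm (u w) v m t @[m --> \oo] --> L v w t.
Proof.
move=> Soo t01; apply: (@cvgn_geometric_increments _ _ (K v w)) => k.
exact: Rm_increment.
Qed.

Let Rm_rate v w t m : (S v w < +oo)%E -> 0 <= t <= 1 ->
  `|L v w t - Rm (u w) v m t| <= 9 * K v w * (8 / 9) ^+ m.
Proof.
move=> Soo t01.
by apply: (@limn_geometric_increments _ (fun m => Rm (u w) v m t)) => k; exact: Rm_increment.
Qed.

(** The value 0 on the exceptional event makes every path càdlàg, not just almost every one, and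
    keeps each coordinate measurable. *)
Definition Rlim v w t : R :=
  if (S v w < +oo)%E && (0 <= t <= 1) then L v w t else 0.

Lemma cadlag_Rlim v w : cadlag01 (Rlim v w).
Proof.
have [Soo|Soo] := boolP (S v w < +oo)%E; last first.
  apply: (@cadlag01_uniform_limit _ (fun _ _ => 0)) => [n|e e0]; first exact: cadlag_cst.
  by exists 0%N => t _; rewrite /Rlim (negbTE Soo) subrr normr0.
apply: (@cadlag01_uniform_limit _ (Rm (u w) v)) => [n|e e0]; first exact: cadlag_Rm.
have q1 : `|8 / 9 : R| < 1 by rewrite ger0_norm; lra.
have /cvgrPdist_lt/(_ _ e0)[N _ hN] := @cvg_geometric R (9 * K v w) (8 / 9) q1.
exists N => t t01; rewrite /Rlim Soo t01 distrC.
apply: (le_lt_trans (Rm_rate N Soo t01)); have /= := hN N (leqnn N).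
by rewrite sub0r normrN => /(le_lt_trans (ler_norm _)).
Qed.

Lemma measurable_Rlim v t : measurable_fun setT (fun w => Rlim v w t).
Proof.
rewrite /Rlim; case: (0 <= t <= 1); last first.
  by under eq_fun do rewrite andbF; exact: measurable_cst.
under eq_fun do rewrite andbT; apply: measurable_fun_ifT => //.
  apply: (measurable_fun_bool true); exact: emeasurable_fun_infty_o.
by apply: measurable_fun_limn => m; exact: measurable_Rm.
Qed.

Lemma Rm_cvg_Rlim v :
  {ae P, forall w, (fun m => supnorm (Rm (u w) v m \- Rlim v w)) @ \oo --> 0%E}.
Proof.
apply: filterS (S_fin v) => w Soo.
have q1 : `|8 / 9 : R| < 1 by rewrite ger0_norm; lra.
have h : (geometric (9 * K v w) (8 / 9) m)%:E @[m --> \oo] --> 0%E.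
  by apply: cvg_EFin; [near=> m|exact: cvg_geometric].
apply: (squeeze_cvge _ (cvg_cst 0%E) h); near=> m.
rewrite supnorm_ge0 /=; apply: supnorm_le => t t01.
by rewrite /= /Rlim Soo t01 distrC; exact: Rm_rate.
Unshelve. all: by end_near. Qed.

(** As R_0 = 0, the rate at m = 0 reads ||R|| <= 9 [K], and squaring gives the integrable majorant
    81 [S]. *)
Lemma expectation_Rlim_sqr v : (\int[P]_w (supnorm (Rlim v w) `^ 2) < +oo)%E.
Proof.
apply: (@le_lt_trans _ _ (\int[P]_w (81%:E * S v w))%E); last first.
  by rewrite ge0_integralZl// lte_mul_pinfty.
apply: le_integral_ae_dominated.
- by move=> w; exact: poweR_ge0.
- by move=> w; rewrite mule_ge0.
- exact: measurable_funeM.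
apply: aeW => w; have [Soo|Soo] := boolP (S v w < +oo)%E; last first.
  apply: (le_trans (@supnorm_poweR_le _ _ 0 2 _ _)) => //.
    by move=> t _; rewrite /Rlim (negbTE Soo) normr0.
  by rewrite powR0// mule_ge0.
apply: (le_trans (@supnorm_poweR_le _ _ (9 * K v w) 2 _ _)) => //.
  move=> t t01; have := Rm_rate 0 Soo t01.
  by rewrite Rm0 subr0 expr0 mulr1 /Rlim Soo t01.
rewrite powR_mulrn; last by rewrite mulr_ge0// sqrtr_ge0.
rewrite exprMn sqr_sqrtr ?fine_ge0// EFinM fineK ?ge0_fin_numE//.
by rewrite lee_pmul// lee_fin; lra.
Qed.

(** The recursion for R_{m+1} passes to the limit pointwise where [S] is finite at v and at both
    children. [Cfun] contains the full limit Q, so it does not change with m. *)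
Lemma Rlim_fixed_point v : {ae P, forall w t, 0 <= t <= 1 ->
  Rlim v w t = Top (V v w) false (Rlim (rcons v false) w) t +
    Top (V v w) true (Rlim (rcons v true) w) t + Cfun (u w) v t}.
Proof.
have := S_fin (rcons v true); have := S_fin (rcons v false); have := S_fin v.
apply: filterS3.
move=> w S0 S1 S2 t t01.
rewrite Top_cases// {1}/Rlim S0 t01 /=.
have h : (Rm (u w) v m.+1 t) @[m --> \oo] --> L v w t.
  by have := Rm_cvg S0 t01; rewrite -cvg_shiftS.
suff : Rm (u w) v m.+1 t @[m --> \oo] --> (if t < V v w
    then V v w * Rlim (rcons v false) w (t / V v w)
    else (1 - V v w) * Rlim (rcons v true) w ((t - V v w) / (1 - V v w))) +
  Cfun (u w) v t by move=> h2; exact: (cvg_unique _ h h2).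
have RmE m : Rm (u w) v m.+1 t = (if t < V v w
    then V v w * Rm (u w) (rcons v false) m (t / V v w)
    else (1 - V v w) * Rm (u w) (rcons v true) m ((t - V v w) / (1 - V v w))) +
  Cfun (u w) v t by rewrite RmS Top_cases// addrC.
under eq_fun do rewrite RmE.
apply: cvgD; last exact: cvg_cst.
case: ltP => tx; apply: cvgM; try exact: cvg_cst.
  have a01 := left_arg_itv (V01 v w) t01 tx.
  by rewrite /Rlim S1 a01; exact: Rm_cvg.
have a01 := right_arg_itv (V01 v w) t01 tx.
by rewrite /Rlim S2 a01; exact: Rm_cvg.
Qed.

End limit.

(** * The L_p bound *)

Section Lnorm_bounds.
Context d (T : measurableType d) (R : realType) (P : {measure set T -> \bar R}).

(** Only the majorant [g] is measurable; [f] will be an uncountable supremum. *)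
Lemma Lnorm_le_ae (p : R) (f : T -> \bar R) (g : T -> R) : 0 < p ->
  (forall w, 0 <= f w)%E -> measurable_fun setT g ->
  {ae P, forall w, (f w <= (g w)%:E)%E} ->
  (Lnorm P p%:E f <= Lnorm P p%:E (EFin \o g))%E.
Proof.
move=> p0 f0 mg fg; rewrite unlock; apply: gt0_ler_poweR.
- by rewrite invr_ge0 ltW.
- by rewrite in_itv/= leey andbT; apply: integral_ge0 => w _; rewrite ?lee_fin ?powR_ge0 ?poweR_ge0.
- by rewrite in_itv/= leey andbT; apply: integral_ge0 => w _; rewrite ?lee_fin ?powR_ge0 ?poweR_ge0.
apply: le_integral_ae_dominated.
- by move=> w; exact: poweR_ge0.
- by move=> w; exact: poweR_ge0.
- suff : measurable_fun setT (EFin \o (fun w => `|g w| `^ p)) by [].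
  apply/measurable_EFinP.
  by apply: (measurableT_comp (measurable_powR p)); exact: measurableT_comp.
apply: filterS fg => w fgw; apply: gt0_ler_poweR; first exact: ltW.
- by rewrite in_itv/= leey andbT ?lee_fin ?abse_ge0.
- by rewrite in_itv/= leey andbT ?lee_fin ?abse_ge0.
by rewrite gee0_abs// (le_trans fgw)//= lee_fin ler_norm.
Qed.

Lemma Lnorm_ae_eq (p : R) (f g : T -> R) :
  measurable_fun setT f -> measurable_fun setT g ->
  {ae P, forall w, f w = g w} ->
  Lnorm P p%:E (fun w => (f w)%:E) = Lnorm P p%:E (fun w => (g w)%:E).
Proof.
move=> mf mg fg; rewrite unlock; congr (_ `^ _)%E.
have m (h : T -> R) : measurable_fun setT h ->
    measurable_fun setT (fun w => (`|(h w)%:E| `^ p)%E).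
  move=> mh; suff : measurable_fun setT (EFin \o (fun w => `|h w| `^ p)) by [].
  apply/measurable_EFinP; apply: (measurableT_comp (measurable_powR p)).
  exact: measurableT_comp.
apply: ae_eq_integral; [exact: measurableT|exact: m|exact: m|].
by apply: filterS fg => w -> _.
Qed.

Lemma Lnorm_powRV (p : R) (f : T -> R) : 0 < p -> (forall w, 0 <= f w) ->
  Lnorm P p%:E (EFin \o (fun w => f w `^ p^-1)) = ((\int[P]_w (f w)%:E) `^ p^-1)%E.
Proof.
move=> p0 f0; rewrite unlock; congr (_ `^ _)%E; apply: eq_integral => w _ /=.
by rewrite ?poweR_EFin ger0_norm ?powR_ge0// -powRrM mulVf ?gt_eqF// powRr1.
Qed.

Lemma Lnorm_sum_le (p : R) (g : nat -> T -> R) m : 1 <= p ->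
  (forall k, measurable_fun setT (g k)) ->
  (Lnorm P p%:E (EFin \o (fun w => \sum_(k < m) g k w)%R) <=
   \sum_(k < m) Lnorm P p%:E (EFin \o g k))%E.
Proof.
move=> p1 mg; elim: m => [|m IHm].
  rewrite big_ord0 (@eq_Lnorm _ _ _ _ _ _ (cst 0%E)).
    by rewrite Lnorm0// eqe gt_eqF// (lt_le_trans ltr01).
  by move=> w /=; rewrite big_ord0.
rewrite big_ord_recr /=; apply: (le_trans _ (leeD IHm (lexx _))).
have mS : measurable_fun setT (fun w => \sum_(k < m) g k w) by exact: measurable_sum.
apply: (le_trans _ (minkowski_EFin _ mS (mg m) p1)).
by rewrite le_eqVlt; apply/orP; left; apply/eqP; apply: eq_Lnorm => w /=; rewrite big_ord_recr.
Qed.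

End Lnorm_bounds.

Section Lp_bound.
Context (R : realType) d (T : measurableType d) (P : probability T R).
Context (V : word -> T -> R).
Hypothesis mV : forall v, measurable_fun setT (V v).
Hypothesis indV : mutually_independent P V.
Hypothesis idV : forall v w B, measurable B -> P (V v @^-1` B) = P (V w @^-1` B).
Hypothesis V01 : forall v w, 0 < V v w < 1.
Hypothesis V_moment : forall v p, 0 < p ->
  (\int[P]_w (V v w `^ p)%:E = ((p + 1)^-1)%:E)%E.
Hypothesis onemV_moment : forall v p, 0 < p ->
  (\int[P]_w ((1 - V v w) `^ p)%:E = ((p + 1)^-1)%:E)%E.
Context (p : R).
Hypothesis p1 : 1 < p.

Local Notation u w := (fun v => V v w).

Let p0 : 0 < p. Proof. exact: lt_trans p1. Qed.

Let NQ := Lnorm P p%:E (fun w => (Q (u w) [::])%:E).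

Lemma kp_ge0 : 0 <= kp p. Proof. exact: powR_ge0. Qed.

Lemma kp_lt1 : kp p < 1.
Proof.
apply: (@lt_le_trans _ _ (1 `^ p^-1)); last by rewrite powR1.
have q0 : 0 < p + 1 by apply: addr_gt0.
apply: gt0_ltr_powR; rewrite ?nnegrE ?ler01 ?invr_gt0 ?divr_ge0 ?(ltW q0)//.
by rewrite ltr_pdivrMr//; have := p1; lra.
Qed.

(** The left side is the L_p norm of U, which explains the factor 2^(-1/p) k_p in the bound. *)
Lemma kp_scaled : (p + 1)^-1 `^ p^-1 = 2 `^ (- p^-1) * kp p.
Proof.
rewrite /kp powRM ?invr_ge0//; last by have := p0; lra.
by rewrite powRN mulKf// gt_eqF// powR_gt0.
Qed.

(** Minkowski for 8 + U |Q|: the constant has norm 8 under a probability, and by independence the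
    norm of U |Q| is the product of the norms. *)
Lemma Lnorm_Mp0 : ((\int[P]_w (Mp (u w) p [::] 0)%:E) `^ p^-1 <=
  8%:E + (2 `^ (- p^-1) * kp p)%:E * NQ)%E.
Proof.
pose h w := V [::] w * `|Q (u w) [:: false]|.
have h0 w : 0 <= h w by rewrite mulr_ge0//; have /andP[/ltW] := V01 [::] w.
have mh : measurable_fun setT h.
  by apply: measurable_funM => //; apply: measurableT_comp => //; exact: measurable_Q.
have -> : ((\int[P]_w (Mp (u w) p [::] 0)%:E) `^ p^-1 =
    Lnorm P p%:E (EFin \o ((cst 8%R : T -> R) \+ h)%R))%E.
  rewrite unlock; congr (_ `^ _)%E; apply: eq_integral => w _ /=.
  by congr (_%:E); rewrite [in RHS]ger0_norm// addr_ge0.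
have mc : measurable_fun setT (cst 8 : T -> R) by exact: measurable_cst.
apply: (le_trans (minkowski_EFin _ mc mh (ltW p1))); apply: leeD.
  rewrite unlock /= (eq_integral (fun=> (8 `^ p)%:E)); last first.
    by move=> w _; rewrite ?poweR_EFin ger0_norm.
  rewrite integral_cst// [X in (_ * X)%E](_ : _ = 1%E); last exact: probability_setT.
  by rewrite mule1 poweR_EFin -powRrM divff ?gt_eqF// powRr1.
rewrite unlock (eq_integral (fun w => (h w `^ p)%:E)); last first.
  by move=> w _ /=; rewrite ?poweR_EFin ger0_norm.
rewrite (expectation_VQ mV indV idV V01 V_moment [::] false p0).
rewrite poweRM ?lee_fin ?invr_ge0//; last 2 first.
- by have := p0; lra.
- by apply: integral_ge0 => w _; rewrite lee_fin powR_ge0.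
rewrite poweR_EFin kp_scaled /NQ unlock lee_wpmul2l//.
by rewrite lee_fin mulr_ge0// ?powR_ge0.
Qed.

Lemma Lnorm_Mp k v : (Lnorm P p%:E (EFin \o (fun w => Mp (u w) p v k `^ p^-1)%R) <=
  (kp p ^+ k)%:E * (8%:E + (2 `^ (- p^-1) * kp p)%:E * NQ))%E.
Proof.
rewrite Lnorm_powRV//; last by move=> w; exact: Mp_ge0.
rewrite (expectation_Mp mV indV idV V01 V_moment onemV_moment v k p0).
have r0 : 0 <= 2 / (p + 1) by rewrite divr_ge0//; have := p0; lra.
rewrite poweRM ?lee_fin ?exprn_ge0//; last first.
  by apply: integral_ge0 => w _; rewrite lee_fin Mp_ge0.
have -> : (((2 / (p + 1)) ^+ k)%:E `^ p^-1 = (kp p ^+ k)%:E)%E.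
  by rewrite poweR_EFin -(powR_mulrn k r0) -powRrM (mulrC k%:R) powRrM powR_mulrn ?powR_ge0.
by apply: lee_wpmul2l; [rewrite lee_fin exprn_ge0// powR_ge0|exact: Lnorm_Mp0].
Qed.

(** Triangle inequality over the increments, then the geometric series in k_p. The abstract [f] is
    the norm built from the original U, which agrees only almost surely with that of the clamped
    family. *)
Lemma Lnorm_Rm_le (f : T -> \bar R) v m : (forall w, 0 <= f w)%E ->
  {ae P, forall w, f w = supnorm (Rm (u w) v m)} ->
  (Lnorm P p%:E f <=
    (8%:E + (2 `^ (- p^-1) * kp p)%:E * NQ) * ((1 - kp p)^-1)%:E)%E.
Proof.
move=> f0 fE.
have mg k : measurable_fun setT (fun w => Mp (u w) p v k `^ p^-1).
  by apply: (measurableT_comp (measurable_powR p^-1)); exact: measurable_Mp.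
have C0 : (0 <= 8%:E + (2 `^ (- p^-1) * kp p)%:E * NQ)%E.
  by rewrite adde_ge0// mule_ge0 ?Lnorm_ge0// lee_fin mulr_ge0 ?powR_ge0.
apply: (@le_trans _ _ (Lnorm P p%:E (EFin \o (fun w => \sum_(k < m) Mp (u w) p v k `^ p^-1)%R))).
  apply: Lnorm_le_ae => //; first exact: measurable_sum.
  apply: filterS fE => w ->; apply: supnorm_le => t t01.
  rewrite Rm_Rdiff (le_trans (ler_norm_sum _ _ _))//; apply: ler_sum => k _.
  by apply: Rdiff_bound => // v'; exact: V01.
apply: (le_trans (@Lnorm_sum_le _ _ _ P p _ m (ltW p1) mg)).
apply: (@le_trans _ _ (\sum_(k < m) (kp p ^+ k)%:E * (8%:E + (2 `^ (- p^-1) * kp p)%:E * NQ))%E).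
  by apply: lee_sum => k _; exact: Lnorm_Mp.
rewrite -ge0_sume_distrl; last by move=> k _; rewrite lee_fin exprn_ge0// kp_ge0.
rewrite muleC lee_wpmul2l// sumEFin lee_fin.
have k1 : 0 < 1 - kp p by rewrite subr_gt0 kp_lt1.
rewrite -[leRHS]mul1r ler_pdivlMr// mulrC.
have -> : (1 - kp p) * \sum_(k < m) kp p ^+ k = 1 - kp p ^+ m.
  by rewrite -[X in _ = X - _](expr1n _ m) subrXX; congr (_ * _);
     apply: eq_bigr => k _; rewrite expr1n mul1r.
by rewrite gerBl exprn_ge0// kp_ge0.
Qed.

End Lp_bound.

(** * Clamping U to the open unit interval *)

Section clamped_family.
Context (R : realType) d (T : measurableType d) (P : probability T R).
Context (U : word -> {RV P >-> R}).
Hypothesis U_indep : mutually_independent P (fun v => (U v : T -> R)).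
Hypothesis U_unif : forall (v : word) (A : set R), measurable A ->
  distribution P (U v) A = uniform_prob (@ltr01 R) A.

Definition clamped v w : R := clamp01 (U v w).

Lemma measurable_clamped v : measurable_fun setT (clamped v).
Proof. exact: (measurableT_comp (@measurable_clamp01 R)). Qed.

Let measurable_clamp01_preimage (B : set R) : measurable B ->
  measurable (@clamp01 R @^-1` B).
Proof. by move=> mB; rewrite -[X in measurable X]setTI; exact: measurable_clamp01. Qed.

Lemma clamped_indep : mutually_independent P clamped.
Proof.
move=> J B uJ mB.
have h := U_indep (B := fun j => @clamp01 R @^-1` B j) uJ (fun j => measurable_clamp01_preimage (mB j)).
exact: h.
Qed.

Lemma clamped_same_law v w B : measurable B ->
  P (clamped v @^-1` B) = P (clamped w @^-1` B).
Proof.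
move=> /measurable_clamp01_preimage mB.
by have := U_unif v mB; rewrite -(U_unif w mB).
Qed.

Lemma clamped_moment v (p : R) : 0 < p ->
  (\int[P]_w (clamped v w `^ p)%:E = ((p + 1)^-1)%:E)%E.
Proof.
move=> p0; rewrite -integral_powR01//.
apply: (@expectation_clamp01 _ _ _ _ (U v) (U_unif v) (fun x => x `^ p)).
  exact: measurable_powR.
by move=> x; exact: powR_ge0.
Qed.

Lemma onem_clamped_moment v (p : R) : 0 < p ->
  (\int[P]_w ((1 - clamped v w) `^ p)%:E = ((p + 1)^-1)%:E)%E.
Proof.
move=> p0; rewrite -integral_onem_powR01//.
apply: (@expectation_clamp01 _ _ _ _ (U v) (U_unif v) (fun x => (1 - x) `^ p)).
  by apply: (measurableT_comp (measurable_powR p)); exact: measurable_funB.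
by move=> x; exact: powR_ge0.
Qed.

(** [expectation_clamp01] handles nonnegative integrands. Adding 3 makes [Cx] nonnegative on [0, 1],
    the absolute value takes care of the rest of the line, and 3 is subtracted at the end. *)
Lemma expectation_Cx_clamped v : (\int[P]_w (Cx (clamped v w))%:E = 0)%E.
Proof.
have C3 x : 0 <= x <= 1 -> `|Cx x + 3| = Cx x + 3 :> R.
  by move=> /Cx_bound; rewrite ler_norml => ?; rewrite ger0_norm//; lra.
have mC := @measurable_Cx R.
have mC3 : measurable_fun setT (fun x : R => `|Cx x + 3|).
  by apply: measurableT_comp => //; exact: measurable_funD.
have bC : bmeas (fun w => Cx (clamped v w)).
  split; first by apply: (measurableT_comp mC); exact: measurable_clamped.
  by exists 3 => w; apply: Cx_bound; have := clamp01_itv (U v w); rewrite /clamped; lra.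
have I3 : (\int[lebesgue_measure]_(x in `[0%R, 1%R]) (`|Cx x + 3|%:E : \bar R) = 3%:E)%E.
  have lty : (lebesgue_measure (`[0%R, 1%R]%classic : set R) = 1)%E.
    by rewrite lebesgue_measure_itv/= lte01 sube0.
  transitivity (\int[lebesgue_measure]_(x in `[0%R, 1%R]) ((Cx x)%:E + (3 : R)%:E))%E.
    by apply: eq_integral => x; rewrite inE/= in_itv/= => x01; rewrite C3.
  rewrite integralD//; last 2 first.
  - apply: continuous_compact_integrable; first exact: segment_compact.
    exact: continuous_subspaceT (@continuous_Cx R).
  - apply: continuous_compact_integrable; first exact: segment_compact.
    by apply: continuous_subspaceT => x; exact: cvg_cst.
  by rewrite integral_Cx01 add0e integral_cst//= lty mule1.
have := @expectation_clamp01 _ _ _ _ (U v) (U_unif v) (fun x => `|Cx x + 3|) mC3 (fun=> normr_ge0 _).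
rewrite I3 (eq_integral (fun w => (Cx (clamped v w) + 3)%:E)); last first.
  by move=> w _; rewrite C3//; have := clamp01_itv (U v w); lra.
rewrite bmeas_expectationD//; last exact: bmeas_cst.
rewrite integral_cst// [X in (_ + _ * X)%E](_ : _ = 1%E); last exact: probability_setT.
rewrite mule1.
have fC : (\int[P]_w (Cx (clamped v w))%:E)%E \is a fin_num.
  by apply: integrable_fin_num => //; exact: bmeas_integrable.
by rewrite -(fineK fC) -EFinD => -[h]; congr (_%:E); lra.
Qed.

(** Words are countable: the null sets are united along [pickle]. *)
Lemma clamped_ae : {ae P, forall w, forall v, clamped v w = U v w}.
Proof.
have h n : {ae P, forall w, forall v, unpickle n = Some v -> clamped v w = U v w}.
  case: (unpickle n) => [v|]; last exact: aeW.
  by apply: filterS (clamp01_ae (U_unif v)) => w vE _ [<-].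
apply: filterS (ae_foralln h) => w hw v.
exact: (hw (pickle v) v (pickleK v)).
Qed.

End clamped_family.

Theorem mainTheorem3 (R : realType) (d : measure_display) (T : measurableType d)
  (P : probability T R) (U : word -> {RV P >-> R})
  (U_indep : mutually_independent P (fun v => (U v : T -> R)))
  (U_unif : forall (v : word) (A : set R), measurable A ->
     distribution P (U v) A = uniform_prob (@ltr01 R) A) :
  let u (w : T) : word -> R := fun v => U v w in
  (exists RR : word -> T -> R -> R,
    forall v : word,
      (* R^v is a random element of D *)
      (forall w, cadlag01 (RR v w)) /\
      (forall t, measurable_fun setT (fun w => RR v w t)) /\
      (* a.s. uniform convergence of R^v_m to R^v *)
      {ae P, forall w, (fun m => supnorm (Rm (u w) v m \- RR v w)) @ \oo --> 0%E} /\
      (* E ||R^v||^2 < oo *)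
      (\int[P]_w (supnorm (RR v w) `^ 2) < +oo)%E /\
      (* the recursive distributional fixed-point equation, a.s. *)
      {ae P, forall w, forall t, t \in `[0, 1] ->
         RR v w t = Top (u w v) false (RR (rcons v false) w) t
                    + Top (u w v) true (RR (rcons v true) w) t
                    + Cfun (u w) v t}) /\
  (forall p : R, 1 < p -> forall (v : word) (m : nat),
     (Lnorm P p%:E (fun w => supnorm (Rm (u w) v m))
      <= (8%:E + (2 `^ (- p^-1) * kp p)%:E * Lnorm P p%:E (fun w => (Q (u w) [::])%:E))
         * ((1 - kp p)^-1)%:E)%E).
Proof.
move=> u; pose V := clamped U.
have mV := measurable_clamped U.
have indV := clamped_indep U_indep.
have idV := clamped_same_law U_unif.
have V01 v w : 0 < V v w < 1 by exact: clamp01_itv.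
have V_moment := clamped_moment U_unif.
have onemV_moment := onem_clamped_moment U_unif.
have V_Cx := expectation_Cx_clamped U_unif.
(* Equality of whole realizations on one event allows [Rm], [Q] and [Cfun] to be rewritten at
   once. *)
have uE : {ae P, forall w, (fun v => V v w) = u w}.
  by apply: filterS (clamped_ae U_unif) => w hw; exact/funext.
split.
  exists (Rlim V) => v; split; first by move=> w; exact: cadlag_Rlim.
  split; first by move=> t; exact: measurable_Rlim.
  split.
    apply: filterS2 (Rm_cvg_Rlim mV indV idV V01 V_moment onemV_moment V_Cx v) uE.
    by move=> w + <-.
  split; first exact: expectation_Rlim_sqr.
  apply: filterS2 (Rlim_fixed_point mV indV idV V01 V_moment onemV_moment V_Cx v) uE.
  by move=> w + <- t; rewrite in_itv/= => + t01 => /(_ t t01).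
move=> p p1 v m.
have p0 : 0 < p by exact: lt_trans p1.
have -> : Lnorm P p%:E (fun w => (Q (u w) [::])%:E) =
    Lnorm P p%:E (fun w => (Q (fun v => V v w) [::])%:E).
  apply: Lnorm_ae_eq.
  - exact: (@measurable_Q _ _ _ (fun v => U v : T -> R)).
  - exact: (measurable_Q mV).
  - by apply: filterS uE => w ->.
apply: Lnorm_Rm_le => //.
  by move=> w; exact: supnorm_ge0.
by apply: filterS uE => w ->.
Qed.
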